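(* Let $\bm k=(k_1,k_2)\in\mathbb N^2$ and $\mathcal G=\mathcal G_{\mathrm{tight}}$. Below, $\cong$ denotes the bijections given by the displayed parametrizations (group isomorphisms in part (c)). (a) The range fibres $\mathcal G^u=r^{-1}(u)$ are: (i) $\mathcal G^{\phi(\infty,\infty)}=\{[\phi(\infty,\infty),B_1(r,\bm 0,(r,r))]:r\in\mathbb Z_+\}\cup\{[\phi(\infty,\infty),B_1(r,(-r,-r),\bm 0)]:r\in\mathbb Z_-\}\cong\mathbb Z$; (ii) $\mathcal G^{\phi(\infty,k_2)}=\{[\phi(\infty,k_2),B_2(r,(k_2+m,k_2),(r+k_2+m,m))]:m\in\mathbb N,r\in\mathbb Z_+\}\cup\{[\phi(\infty,k_2),B_2(r,(k_2+m-r,k_2),(k_2+m,m))]:m\in\mathbb N,r\in\mathbb Z_-\}\cong\mathbb N\times\mathbb Z$; (iii) $\mathcal G^{\phi(k_1,\infty)}=\{[\phi(k_1,\infty),B_3(r,(k_1,k_1+m),(m,r+k_1+m))]:m\in\mathbb N,r\in\mathbb Z_+\}\cup\{[\phi(k_1,\infty),B_3(r,(k_1,k_1+m-r),(m,k_1+m))]:m\in\mathbb N,r\in\mathbb Z_-\}\cong\mathbb N\times\mathbb Z$; (iv) $\mathcal G^{\phi(\bm k)}=\{[\phi(\bm k),B_4(r,\bm k,\bm m)]:\bm m\in\mathbb N^2,r\in\mathbb Z\}\cong\mathbb N\times\mathbb N\times\mathbb Z$. (b) The source fibres $\mathcal G_u=s^{-1}(u)$ are: (i) $\mathcal G_{\phi(\infty,\infty)}=\{[\phi(\infty,\infty),B_1(r,\bm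 0,(r,r))]:r\in\mathbb Z_+\}\cup\{[\phi(\infty,\infty),B_1(r,(-r,-r),\bm 0)]:r\in\mathbb Z_-\}\cong\mathbb Z$; (ii) $\mathcal G_{\phi(\infty,k_2)}=\{[\phi(\infty,n),B_2(r,(n+k_2,n),(r+n+k_2,k_2))]:n\in\mathbb N,r\in\mathbb Z_+\}\cup\{[\phi(\infty,n),B_2(r,(n+k_2-r,n),(n+k_2,k_2))]:n\in\mathbb N,r\in\mathbb Z_-\}\cong\mathbb N\times\mathbb Z$; (iii) $\mathcal G_{\phi(k_1,\infty)}=\{[\phi(n,\infty),B_3(r,(n,n+k_1),(k_1,r+n+k_1))]:n\in\mathbb N,r\in\mathbb Z_+\}\cup\{[\phi(n,\infty),B_3(r,(n,n+k_1-r),(k_1,n+k_1))]:n\in\mathbb N,r\in\mathbb Z_-\}\cong\mathbb N\times\mathbb Z$; (iv) $\mathcal G_{\phi(\bm k)}=\{[\phi(\bm n),B_4(r,\bm n,\bm k)]:\bm n\in\mathbb N\times\mathbb N,r\in\mathbb Z\}\cong\mathbb N\times\mathbb N\times\mathbb Z$. (c) The isotropy groups $\mathcal G_u^u=\mathcal G^u\cap\mathcal G_u$ are: (i) $\mathcal G_{\phi(\infty,\infty)}^{\phi(\infty,\infty)}=\{[\phi(\infty,\infty),B_1(r,\bm 0,(r,r))]:r\in\mathbb Z_+\}\cup\{[\phi(\infty,\infty),B_1(r,(-r,-r),\bm 0)]:r\in\mathbb Z_-\}\cong\mathbb Z$; (ii) $\mathcal G_{\phi(\infty,k_2)}^{\phi(\infty,k_2)}=\{[\phi(\infty,k_2),B_2(r,(2k_2,k_2),(r+2k_2,k_2))]:r\in\mathbb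 Z_+\}\cup\{[\phi(\infty,k_2),B_2(r,(2k_2-r,k_2),(2k_2,k_2))]:r\in\mathbb Z_-\}\cong\mathbb Z$; (iii) $\mathcal G_{\phi(k_1,\infty)}^{\phi(k_1,\infty)}=\{[\phi(k_1,\infty),B_3(r,(k_1,2k_1),(k_1,r+2k_1))]:r\in\mathbb Z_+\}\cup\{[\phi(k_1,\infty),B_3(r,(k_1,2k_1-r),(k_1,2k_1))]:r\in\mathbb Z_-\}\cong\mathbb Z$; (iv) $\mathcal G_{\phi(\bm k)}^{\phi(\bm k)}=\{[\phi(\bm k),B_4(r,\bm k,\bm k)]:r\in\mathbb Z\}\cong\mathbb Z$.
   Context: $\mathbb N=\{0,1,2,\dots\}$, $\overline{\mathbb N}=\mathbb N\cup\{\infty\}$, $\mathbb Z_+$ denotes the nonnegative and $\mathbb Z_-$ the negative integers. $S$ is the left shift on $\ell^2(\mathbb N)$ ($Se_0=0$, $Se_n=e_{n-1}$), $p$ is the rank-one projection onto $\mathbb Ce_0$, and $\bm t$ is the left shift on $\ell^2(\mathbb Z)$ ($\bm te_n=e_{n-1}$). The inverse semigroup $T$ of operators on $\ell^2(\mathbb N)\otimes\ell^2(\mathbb N)\otimes\ell^2(\mathbb Z)$: for $\bm n=(n_1,n_2),\bm m=(m_1,m_2)\in\mathbb N^2$, $r\in\mathbb Z$, let $B_1(r,\bm n,\bm m)=S^{*n_1}S^{m_1}\otimes S^{*n_1}S^{m_1}\otimes\bm t^r$ for $n_1=n_2$, $m_1=m_2$, $r=m_1-n_1$; $B_2(r,\bm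 n,\bm m)=S^{*n_1}S^{m_1}\otimes S^{*n_2}pS^{m_2}\otimes\bm t^r$ for $r=m_1-n_1$, $n_1\ge n_2$, $m_1\ge m_2$; $B_3(r,\bm n,\bm m)=S^{*n_1}pS^{m_1}\otimes S^{*n_2}S^{m_2}\otimes\bm t^r$ for $r=m_2-n_2$, $n_1\le n_2$, $m_1\le m_2$; $B_4(r,\bm n,\bm m)=S^{*n_1}pS^{m_1}\otimes S^{*n_2}pS^{m_2}\otimes\bm t^r$ for any $r\in\mathbb Z$. $T$ is the set of all these operators together with $0$, an inverse semigroup under operator product and adjoint. $E$ is its commutative semigroup of projections, ordered by $e\le f\iff fe=e$; its nonzero elements are $P_i(\bm n)=B_i(0,\bm n,\bm n)$ (with $n_1=n_2$ if $i=1$; $n_1\ge n_2$ if $i=2$; $n_1\le n_2$ if $i=3$). $\widehat E_0$ is the set of nonzero semigroup homomorphisms $x:E\to\{0,1\}$ with $x(0)=0$. A filter is a nonempty $A\subseteq E\setminus\{0\}$ that is upward closed and closed under products; ultrafilters are maximal filters. $\widehat E_\infty=\{x\in\widehat E_0:x^{-1}(1)\text{ is an ultrafilter}\}$ and $\widehat E_{\mathrm{tight}}$ is its closure in $\widehat E_0\subseteq\{0,1\}^E$ (product topology). For $\bm k\in\overline{\mathbb N}^2$ put $\Lambda(\bm k)=\{P_4(\bm k)\}$ if $\bm k\in\mathbb N^2$; $\Lambda(k_1,\infty)=\{P_3((k_1,l)):l\in\mathbb N,\ l\ge k_1\}$ and $\Lambda(\infty,k_2)=\{P_2((l,k_2)):l\in\mathbb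 N,\ l\ge k_2\}$ for $k_1,k_2\in\mathbb N$; $\Lambda(\infty,\infty)=\{P_1((l,l)):l\in\mathbb N\}$. Let $A_{\Lambda(\bm k)}=\{f\in E:fe=e\text{ for some }e\in\Lambda(\bm k)\}$ and $\phi(\bm k)=1_{A_{\Lambda(\bm k)}}$. It is known that $\widehat E_{\mathrm{tight}}=\{\phi(\bm k):\bm k\in\overline{\mathbb N}^2\}$. For $s\in T$ let $D_s=\{x\in\widehat E_0:x(ss^* )=1\}$, and for $x\in D_s$ let $(x\cdot s)(e)=x(ses^* )$. Let $\Sigma=\{(x,s):s\in T,\ x\in D_s\}$, with $(x,s)\sim(y,s')$ iff $x=y$ and $es=es'$ for some $e\in E$ with $x(e)=1$; $[x,s]$ denotes the class of $(x,s)$. $\mathcal G'=\Sigma/\sim$ is a groupoid with $[x,s][x\cdot s,s']=[x,ss']$, $[x,s]^{-1}=[x\cdot s,s^*]$; its unit space is $\widehat E_0$ via $[x,1]\leftrightarrow x$, so $[x,s]$ has range $x$ and source $x\cdot s$. $\mathcal G_{\mathrm{tight}}$ is the reduction of $\mathcal G'$ to $\widehat E_{\mathrm{tight}}$. *)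

(* Defs.v *)
From HB Require Import structures.
From mathcomp Require Import all_boot all_order all_algebra.
From mathcomp Require Import all_classical all_reals all_analysis.
From mathcomp.real_closed Require Import complex.
From mathcomp.analysis.showcase Require summability.

Set Implicit Arguments.
Unset Strict Implicit.
Unset Printing Implicit Defensive.
Import Order.TTheory GRing.Theory Num.Theory numFieldNormedType.Exports.

Local Open Scope classical_set_scope.
Local Open Scope ring_scope.
Local Open Scope complex_scope.

Section L2.
Context (R : realType).

(* |z|^2 = (Re z)^2 + (Im z)^2 *)
Definition sqsummable (I : choiceType) (f : I -> R[i]) : Prop :=
  (\esum_(i in [set: I])
     (complex.Re (f i) ^+ 2 + complex.Im (f i) ^+ 2)%:E < +oo)%E.

Record l2 (I : choiceType) := L2 {
  l2_fun :> I -> R[i];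
  l2P : sqsummable l2_fun }.

HB.instance Definition _ (I : choiceType) := gen_eqMixin (l2 I).
HB.instance Definition _ (I : choiceType) := gen_choiceMixin (l2 I).

Lemma sqsummable0 (I : choiceType) : sqsummable (fun _ : I => 0 : R[i]).
Proof.
rewrite /sqsummable esum1 ?ltry// => i _ /=.
by rewrite expr0n addr0.
Qed.

Definition zero_l2 (I : choiceType) : l2 I := L2 (@sqsummable0 I).

Lemma sqsummable_pull (I J : choiceType) (P : pred J) (e : J -> I)
    (f : I -> R[i]) : {in P &, injective e} -> sqsummable f ->
  sqsummable (fun j => if P j then f (e j) else 0).
Proof.
move=> injP; apply: le_lt_trans.
pose g i : \bar R := (complex.Re (f i) ^+ 2 + complex.Im (f i) ^+ 2)%:E.
have g0 i : (0 <= g i)%E by rewrite lee_fin addr_ge0 ?sqr_ge0.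
rewrite [leLHS](_ : _ = \esum_(j in [set j | P j]) g (e j))%E; last first.
  rewrite [RHS]esum_mkcond; apply: eq_esum => j _.
  by rewrite mem_setE /g unfold_in; case: (P j) => //=; rewrite expr0n addr0.
rewrite -(esum_image [set j | P j] e g); last by move=> x y /[!inE]; exact: injP.
rewrite esum_mkcond; apply: le_esum => i _.
by case: ifPn => // _; exact: g0.
Qed.

(* A square-summable family viewed in l^2(I).  The value [zero_l2] is a
   default, never reached for the operators generated by shifts below. *)
Definition to_l2 (I : choiceType) (f : I -> R[i]) : l2 I :=
  if pselect (sqsummable f) is left h then L2 h else zero_l2 I.

(* <f, g> = sum_i f i * conj (g i), the sum being the limit of the net of all
   finite partial sums. *)
Definition inner (I : choiceType) (f g : l2 I) : R[i] :=
  summability.sum ((fun i => f i * (g i)^*) : I -> (R[i])^o).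

Definition is_adjoint (I : choiceType) (A B : l2 I -> l2 I) : Prop :=
  forall f g, inner (A f) g = inner f (B g).

Definition adj (I : choiceType) (A : l2 I -> l2 I) : l2 I -> l2 I :=
  xget (fun=> zero_l2 I) [set B | is_adjoint A B].

Definition opow (I : choiceType) (A : l2 I -> l2 I) (n : nat) : l2 I -> l2 I :=
  fun f => iter n A f.

(* S e_0 = 0 and S e_n = e_(n-1) read (S f) n = f (n + 1) on coordinates. *)
Lemma shiftN_subproof (f : l2 nat) : sqsummable (fun n : nat => f n.+1).
Proof. by apply: (@sqsummable_pull _ _ predT succn f _ (l2P f)) => ? ? _ _ []. Qed.

Definition shiftN (f : l2 nat) : l2 nat := L2 (shiftN_subproof f).

Lemma proj0_subproof (f : l2 nat) :
  sqsummable (fun n : nat => if n == 0%N then f n else 0).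
Proof. exact: (@sqsummable_pull _ _ (pred1 0%N) id f _ (l2P f)). Qed.

Definition proj0 (f : l2 nat) : l2 nat := L2 (proj0_subproof f).

Lemma shiftZ_subproof (f : l2 int) : sqsummable (fun n : int => f (n + 1)).
Proof.
by apply: (@sqsummable_pull _ _ predT (+%R^~ 1) f _ (l2P f)) => ? ? _ _ /addIr.
Qed.

Definition shiftZ (f : l2 int) : l2 int := L2 (shiftZ_subproof f).

(* t is unitary, so t^r = (t^* )^|r| for r < 0. *)
Definition shiftZ_pow (r : int) : l2 int -> l2 int :=
  if 0 <= r then opow shiftZ `|r|%N else opow (adj shiftZ) `|r|%N.

(* l^2(N) (x) l^2(N) (x) l^2(Z) is l^2(N x N x Z), with
   (f (x) g (x) h) (i, j, l) = f i * g j * h l. *)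
Definition H : Type := l2 (nat * nat * int)%type.
Definition op : Type := H -> H.

(* A (x) B (x) C = (A (x) 1 (x) 1) (1 (x) B (x) 1) (1 (x) 1 (x) C), where each
   factor acts slicewise on its own variable. *)
Definition tensor (A B : l2 nat -> l2 nat) (C : l2 int -> l2 int) : op :=
  fun f => to_l2 (fun x : nat * nat * int =>
    A (to_l2 (fun i =>
      B (to_l2 (fun j =>
        C (to_l2 (fun l => f (i, j, l))) x.2)) x.1.2)) x.1.1).

Definition omul (a b : op) : op := a \o b.

Definition zero_op : op := fun=> zero_l2 _.

End L2.

Arguments shiftN {R}.
Arguments proj0 {R}.
Arguments shiftZ_pow {R}.
Arguments zero_op : clear implicits.

Infix "**" := omul (at level 40, left associativity).

Section InverseSemigroup.
Context (R : realType).

Let S : l2 R nat -> l2 R nat := shiftN.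
Let p : l2 R nat -> l2 R nat := proj0.

Definition SS (n m : nat) : l2 R nat -> l2 R nat := opow (adj S) n \o opow S m.
Definition SpS (n m : nat) : l2 R nat -> l2 R nat :=
  opow (adj S) n \o p \o opow S m.

Definition B1 (r : int) (n m : nat * nat) : op R :=
  tensor (SS n.1 m.1) (SS n.1 m.1) (shiftZ_pow r).
Definition B2 (r : int) (n m : nat * nat) : op R :=
  tensor (SS n.1 m.1) (SpS n.2 m.2) (shiftZ_pow r).
Definition B3 (r : int) (n m : nat * nat) : op R :=
  tensor (SpS n.1 m.1) (SS n.2 m.2) (shiftZ_pow r).
Definition B4 (r : int) (n m : nat * nat) : op R :=
  tensor (SpS n.1 m.1) (SpS n.2 m.2) (shiftZ_pow r).

Definition T : set (op R) :=
  [set zero_op R]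
  `|` [set s | exists r n m,
        [/\ n.1 = n.2, m.1 = m.2, r = m.1%:Z - n.1%:Z & s = B1 r n m]]
  `|` [set s | exists r n m,
        [/\ r = m.1%:Z - n.1%:Z, (n.2 <= n.1)%N, (m.2 <= m.1)%N
          & s = B2 r n m]]
  `|` [set s | exists r n m,
        [/\ r = m.2%:Z - n.2%:Z, (n.1 <= n.2)%N, (m.1 <= m.2)%N
          & s = B3 r n m]]
  `|` [set s | exists r n m, s = B4 r n m].

Record E := MkE {
  E_op :> op R;
  E_T : T E_op;
  E_idem : E_op ** E_op = E_op;
  E_self_adj : adj E_op = E_op }.

HB.instance Definition _ := gen_eqMixin E.
HB.instance Definition _ := gen_choiceMixin E.

Definition leE (e f : E) : Prop := f ** e = e :> op R.

(* [ev x a] is x(a) for an operator a in E (and false for a outside E); it is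
   only used at operators which lie in E because T is an inverse semigroup:
   0, products of projections, s s^* and s e s^*. *)
Definition ev (x : E -> bool) (a : op R) : bool :=
  `[< exists2 e : E, e = a :> op R & x e >].

Definition hatE0 : set {ptws E -> bool} :=
  [set x : {ptws E -> bool} | [/\ exists e, x e, ev x (zero_op R) = false
             & forall e f : E, ev x (e ** f) = x e && x f]].

Definition is_filter (A : set E) : Prop :=
  [/\ A !=set0,
      forall e, A e -> E_op e <> zero_op R,
      forall e f, A e -> leE e f -> A f
    & forall e f, A e -> A f -> exists2 g, A g & g = e ** f :> op R].

Definition is_ultrafilter (A : set E) : Prop :=
  is_filter A /\ forall A', is_filter A' -> A `<=` A' -> A' = A.

Definition hatEinfty : set {ptws E -> bool} :=
  [set x : {ptws E -> bool} | hatE0 x /\ is_ultrafilter [set e | x e]].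

Definition hatEtight : set {ptws E -> bool} := closure hatEinfty `&` hatE0.

(* In indices k, [None] stands for infinity. *)
Definition Lambda (k : option nat * option nat) : set (op R) :=
  match k with
  | (Some k1, Some k2) => [set B4 0 (k1, k2) (k1, k2)]
  | (Some k1, None) => [set B3 0 (k1, l) (k1, l) | l in [set l | (k1 <= l)%N]]
  | (None, Some k2) => [set B2 0 (l, k2) (l, k2) | l in [set l | (k2 <= l)%N]]
  | (None, None) => [set B1 0 (l, l) (l, l) | l in [set: nat]]
  end.

Definition phi (k : option nat * option nat) : {ptws E -> bool} :=
  fun f : E => `[< exists2 e, Lambda k e & f ** e = e >].

Definition D (s : op R) : set {ptws E -> bool} :=
  [set x : {ptws E -> bool} | hatE0 x /\ ev x (s ** adj s)].

Definition act (x : {ptws E -> bool}) (s : op R) : {ptws E -> bool} :=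
  fun e : E => ev x (s ** e ** adj s).

Definition Sigma : set ({ptws E -> bool} * op R) :=
  [set q | T q.2 /\ D q.2 q.1].

Definition germ_eq (q q' : {ptws E -> bool} * op R) : Prop :=
  q.1 = q'.1 /\ exists2 e : E, (q.1 : E -> bool) e & e ** q.2 = e ** q'.2.

(* An arrow is an equivalence class, i.e. a subset of Sigma. *)
Definition arrow : Type := set ({ptws E -> bool} * op R).

Definition germ (x : {ptws E -> bool}) (s : op R) : arrow :=
  [set q | Sigma q /\ germ_eq (x, s) q].

Definition has_range (g : arrow) (u : {ptws E -> bool}) : Prop :=
  exists s, Sigma (u, s) /\ g = germ u s.

Definition has_source (g : arrow) (u : {ptws E -> bool}) : Prop :=
  exists x s, [/\ Sigma (x, s), g = germ x s & u = act x s].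

(* [x, s] [x . s, s'] = [x, s s'], and the empty set if g and h are not
   composable. *)
Definition gmul (g h : arrow) : arrow :=
  [set q | exists x s s',
    [/\ Sigma (x, s), Sigma (act x s, s'), g = germ x s,
        h = germ (act x s) s' & germ x (s ** s') q]].

Definition Gtight : set arrow :=
  [set g | exists u v,
    [/\ has_range g u, has_source g v, hatEtight u & hatEtight v]].

Definition range_fibre (u : {ptws E -> bool}) : set arrow :=
  [set g | Gtight g /\ has_range g u].

Definition source_fibre (u : {ptws E -> bool}) : set arrow :=
  [set g | Gtight g /\ has_source g u].

Definition isotropy (u : {ptws E -> bool}) : set arrow :=
  range_fibre u `&` source_fibre u.

(* The map on Z (resp. J x Z) given by [a] on r >= 0 and by [b] on r < 0. *)
Definition glue (a b : int -> arrow) (r : int) : arrow :=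
  if 0 <= r then a r else b r.

Definition bij_Z (F : set arrow) (a b : int -> arrow) : Prop :=
  F = [set a r | r in [set r | 0 <= r]] `|` [set b r | r in [set r | r < 0]]
  /\ set_bij [set: int] F (glue a b).

Definition bij_NZ (F : set arrow) (a b : nat -> int -> arrow) : Prop :=
  F = [set g | exists m r, 0 <= r /\ g = a m r]
      `|` [set g | exists m r, r < 0 /\ g = b m r]
  /\ set_bij [set: nat * int] F (fun q => glue (a q.1) (b q.1) q.2).

Definition bij_NNZ (F : set arrow) (a : nat * nat -> int -> arrow) : Prop :=
  F = [set g | exists m r, g = a m r]
  /\ set_bij [set: (nat * nat) * int] F (fun q => a q.1 q.2).

(* A bijective [p] with [morph_Z p] is an isomorphism of groups from Z onto its
   image. *)
Definition morph_Z (p : int -> arrow) : Prop :=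
  forall r r', p (r + r') = gmul (p r) (p r').

Definition iso_Z (F : set arrow) (a b : int -> arrow) : Prop :=
  bij_Z F a b /\ morph_Z (glue a b).

Definition iso_Z1 (F : set arrow) (a : int -> arrow) : Prop :=
  [/\ F = [set a r | r in [set: int]], set_bij [set: int] F a & morph_Z a].

End InverseSemigroup.

Arguments B1 : clear implicits.
Arguments B2 : clear implicits.
Arguments B3 : clear implicits.
Arguments B4 : clear implicits.
Arguments phi : clear implicits.

(* Main.v *)
Require Import Defs.
From HB Require Import structures.
From mathcomp Require Import all_boot all_order all_algebra finmap zify.
From mathcomp Require Import all_classical all_reals all_analysis.
From mathcomp.real_closed Require Import complex.
From mathcomp.analysis.showcase Require summability.

Set Implicit Arguments.
Unset Strict Implicit.
Unset Printing Implicit Defensive.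
Import Order.TTheory GRing.Theory Num.Theory numFieldNormedType.Exports.
Local Open Scope classical_set_scope.
Local Open Scope ring_scope.

(* Every operator in T is the pullback of l^2 families along a partial injection
   of N x N x Z that translates a quadrant, a ray or a point of N x N; products
   compose these partial injections and adjoints invert them.  The character
   phi k is the trace on E of the filter of neighbourhoods of k in the
   compactification of N x N, so a germ at phi k is determined by how the
   partial injection acts close to k: it sends k to some end m having the same
   infinite coordinates, and shifts Z by some r.  Each such (m, r) occurs, so the
   arrows are the triples (k, m, r), with range phi k, source phi m and product
   (k, m, r) (m, n, r') = (k, n, r + r'). *)

(** [adj] and [to_l2] are given by choice and by a default value, so operator identities do not
    unfold by computation. The way out is that [pull] is faithful on partial injections and
    [pmap_op] reads the partial injection back: identities in T become identities of partial maps,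
    settled by integer arithmetic on their parameters. The compactification is not built as a space;
    its neighbourhoods enter as the sets [cell L K] with growing [L]. The factor l^2(Z) keeps the
    degree visible: at a finite end the first two coordinates see a single point, and r is read off
    from the third. In a source fibre the range of an arrow is a priori an arbitrary character, and
    conjugation by [s] has to identify it as some [phi K]. *)

Local Notation X := (nat * nat * int)%type.
Local Notation idx := (option nat * option nat)%type.

(** * Partial injections and their inverses *)

Section PartialInjections.
Context (I : choiceType).

(** The existence of such a [t] makes [s] injective, and [t] is then determined by [s]. *)
Definition pinverse (s t : I -> option I) : Prop :=
  forall x y, s x = Some y <-> t y = Some x.

Lemma pinverseC s t : pinverse s t -> pinverse t s.
Proof. by move=> st x y; split=> /st. Qed.

(** Diagrammatic order: pulling back is contravariant, so a product [a ** b] runs the partial map of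
    [a] first. *)
Definition pthen (s t : I -> option I) : I -> option I := fun x => obind t (s x).

Lemma pthenP s t x z :
  pthen s t x = Some z <-> exists2 y, s x = Some y & t y = Some z.
Proof.
rewrite /pthen; split; first by case: (s x) => //= y ?; exists y.
by case=> y ->.
Qed.

Lemma pinverse_comp s s' t t' :
  pinverse s s' -> pinverse t t' -> pinverse (pthen s t) (pthen t' s').
Proof.
move=> ss tt x y; split=> /pthenP[z h1 h2]; apply/pthenP; exists z.
- exact/tt.
- exact/ss.
- exact/ss.
- exact/tt.
Qed.

Lemma pinverse_iter s t n : pinverse s t ->
  exists t', pinverse (iter n (pthen s) Some) t'.
Proof.
move=> st; elim: n => [|n [t' h]]; first by exists Some => x y; split=> -[->].
by exists (pthen t' t); exact: pinverse_comp.
Qed.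

End PartialInjections.

(** * Pullbacks of square-summable families, their products and adjoints *)

Section Pull.
Context (R : realType).
Local Notation C := R[i].

Lemma l2_inj (I : choiceType) (f g : l2 R I) : f =1 g -> f = g.
Proof.
case: f g => [f fP] [g gP] /= /funext fg; case: _ / fg gP => gP.
by rewrite (Prop_irrelevance fP gP).
Qed.

Lemma to_l2E (I : choiceType) (f : I -> C) : sqsummable f -> to_l2 f =1 f.
Proof. by rewrite /to_l2; case: pselect. Qed.

Context (I : choiceType).
Implicit Types (s t : I -> option I) (f g : l2 R I).

Definition pull s f : l2 R I := to_l2 (fun x => oapp f 0 (s x)).

(** Injectivity of [s] bounds the square sum of the pullback by that of [f], so the default value in
    [to_l2] does not occur. *)
Lemma pullE s t : pinverse s t ->
  forall f x, pull s f x = oapp f 0 (s x).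
Proof.
move=> st f; apply: to_l2E.
(* The total map [odflt x (s x)] extends [s] arbitrarily; the predicate [s] itself cuts the family
   off outside the domain. *)
have := @sqsummable_pull R I I s (fun x => odflt x (s x)) f _ (l2P f).
rewrite (_ : (fun _ => _) = fun x => oapp f 0 (s x)).
  apply=> x y; rewrite !unfold_in.
  case sx: (s x) => [x'|]//; case sy: (s y) => [y'|]//= _ _ xy.
  by move/st: sx; move/st: sy; rewrite xy => -> [].
by apply/funext => x; case: (s x).
Qed.

Lemma pull_comp s s' t t' : pinverse s s' -> pinverse t t' ->
  pull s \o pull t = pull (pthen s t).
Proof.
move=> ss tt; apply/funext => f; apply: l2_inj => x /=.
rewrite (pullE ss) (pullE (pinverse_comp ss tt)) /pthen; case: (s x) => //= y.
by rewrite (pullE tt).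
Qed.

Lemma sqsummable_delta (j : I) : sqsummable (fun i => (i == j)%:R : C).
Proof.
rewrite /sqsummable.
rewrite (_ : (\esum_(i in _) _)%E =
  (\esum_(i in [set j]) ((1 : R) ^+ 2 + 0 ^+ 2)%:E)%E).
  by rewrite esum_set1 ?ltry// lee_fin addr_ge0 ?sqr_ge0.
rewrite [RHS]esum_mkcond; apply: eq_esum => i _.
have [->|ij] := eqVneq i j; first by rewrite mem_set.
by rewrite memNset /= ?expr0n ?addr0 //; exact/eqP.
Qed.

Definition delta (j : I) : l2 R I := L2 (sqsummable_delta j).

(** The value of [pull s (delta y)] at [x] is 1 if [s x = Some y] and 0 otherwise, so basis vectors
    recover [s]. *)
Lemma pull_inj s s' t t' : pinverse s s' -> pinverse t t' ->
  pull s = pull t -> s = t.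
Proof.
move=> ss tt st; apply/funext => x.
have h y : (s x == Some y) = (t x == Some y).
  have : pull s (delta y) x = pull t (delta y) x by rewrite st.
  rewrite (pullE ss) (pullE tt).
  have E (o : option I) : oapp (delta y) 0 o = (o == Some y)%:R by case: o.
  rewrite !E; case: eqP; case: eqP => // _ _ /eqP.
    by rewrite oner_eq0.
  by rewrite eq_sym oner_eq0.
case sx: (s x) => [y|]; first by have := h y; rewrite sx eqxx => /esym/eqP.
by case tx: (t x) => [y|] //; have := h y; rewrite tx sx eqxx.
Qed.

Import finmap.

(* The images of [totally] under the two nets of partial sums coincide, so the
   limits agree without any convergence argument. *)
Lemma sum_reindex s t (F G : I -> C) : pinverse s t ->
  (forall x, F x = oapp G 0 (s x)) -> (forall y, G y = oapp F 0 (t y)) ->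
  summability.sum (F : I -> C^o) = summability.sum (G : I -> C^o).
Proof.
have half (u v : I -> option I) (A B : I -> C) : pinverse u v ->
    (forall x, A x = oapp B 0 (u x)) -> (forall y, B y = oapp A 0 (v y)) ->
    forall S, (summability.partial_sum (A : I -> C^o) @ summability.totally) S ->
      (summability.partial_sum (B : I -> C^o) @ summability.totally) S.
  move=> uv AB BA S [s0 _ s0S].
  have ocan (a b : I -> option I) : pinverse a b ->
      ocancel a (fun y => odflt y (b y)).
    by move=> ab x; case e: (a x) => [y|] //=; move/ab: e => ->.
  (* For [r] containing the image of [s0], the partial sum of [B] over [r] equals that of [A] over
     [s0] enlarged by the preimages of [r]: indices where [u] or [v] is undefined contribute 0. *)
  exists [fset y in pmap u s0]%fset => // r /= s0r.
  have := s0S (s0 `|` [fset y in pmap v r])%fset; rewrite /= fsubsetUl.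
  move=> /(_ isT); congr (S _); rewrite /summability.partial_sum.
  rewrite -(big_seq_fsetE _ _ predT A) -(big_seq_fsetE _ _ predT B) /=.
  set q := (s0 `|` _)%fset.
  rewrite (eq_bigr (fun x => oapp B 0 (u x))) => [|x _]; last exact: AB.
  transitivity (\sum_(y <- pmap u q) B y).
    elim: (enum_fset q) => [|x l ih]; first by rewrite !big_nil.
    by rewrite big_cons ih /=; case: (u x) => [y|] /=;
      rewrite ?big_cons ?add0r.
  transitivity (\sum_(y <- [seq y <- r | v y]) B y); last first.
    rewrite big_filter big_mkcond; apply: eq_bigr => y _.
    by rewrite BA; case: (v y).
  apply: perm_big; apply: uniq_perm.
  - by apply: pmap_uniq; [exact: ocan uv|exact: fset_uniq].
  - by rewrite filter_uniq ?fset_uniq.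
  move=> y; rewrite mem_pmap mem_filter; apply/mapP/andP.
    case=> x; rewrite in_fsetU inE => /orP[xs|].
      move=> /esym ux; rewrite (proj1 (uv x y) ux); split=> //.
      apply: (fsubsetP s0r); rewrite inE /= mem_pmap.
      by apply/mapP; exists x.
    rewrite mem_pmap => /mapP[z zr /esym/uv uz]; rewrite uz => -[->].
    by move/uv: uz => ->.
  case; case vy: (v y) => [x|] // _ yr; exists x; last by move/uv: vy.
  rewrite in_fsetU inE /= mem_pmap; apply/orP; right.
  by apply/mapP; exists y.
move=> st FG GF; rewrite /summability.sum; congr (lim _).
apply/seteqP; split; first exact: half st FG GF.
exact: half (pinverseC st) GF FG.
Qed.

Lemma inner_delta (j : I) (h : l2 R I) : inner (delta j) h = (h j)^*.
Proof.
have PF := @summability.totally_filter I.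
rewrite /inner /summability.sum.
apply: (@cvg_lim (C^o)); first exact: norm_hausdorff.
(* The net of partial sums is constant once the finite set contains [j]. *)
apply: cvg_near_cst; exists [fset j]%fset => // r /= jr.
rewrite /summability.partial_sum.
rewrite -(big_seq_fsetE _ _ predT (fun i => delta j i * (h i)^*%C)) /=.
rewrite (bigD1_seq j) ?fset_uniq //=; last by rewrite -fsub1set.
by rewrite eqxx mul1r big1 ?addr0 // => i /negbTE ->; rewrite mul0r.
Qed.

(** [adj] chooses among all adjoints, so uniqueness counts as much as existence: reindexing along
    [s] gives one adjoint, and testing against the vectors [delta j] leaves no other. *)
Lemma adj_pull s t : pinverse s t -> adj (pull s) = pull t.
Proof.
move=> st; apply: xget_subset1 => [f g|A B AP BP].
  have ts := pinverseC st.
  apply: (sum_reindex (F := fun x => pull s f x * (g x)^*)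
    (G := fun x => f x * (pull t g x)^*) st) => [x|y].
    rewrite (pullE st); case sx: (s x) => [y|] /=; last by rewrite mul0r.
    by rewrite (pullE ts); move/st: sx => ->.
  rewrite (pullE ts); case ty: (t y) => [x|] /=; last by rewrite rmorph0 mulr0.
  by rewrite (pullE st); move/st: ty => ->.
apply/funext => g; apply: l2_inj => j; apply: (inv_inj conjCK).
by rewrite -!inner_delta -AP -BP.
Qed.

Lemma opow_pull s t n : pinverse s t -> opow (pull s) n = pull (iter n (pthen s) Some).
Proof.
move=> st; elim: n => [|n ih].
  apply/funext => f; apply: l2_inj => x.
  by rewrite (@pullE _ Some) // => y z; split=> -[->].
have [t' h] := pinverse_iter n st.
by rewrite /= -(pull_comp st h) -ih.
Qed.

End Pull.

(** * Shifts, the rank-one projection and their tensor products as pullbacks *)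

Section Factors.
Context (R : realType).

(* [S^*n S^m] for [b = true] and [S^*n p S^m] for [b = false]. *)
Definition fac (b : bool) (n m i : nat) : option nat :=
  if (if b then n <= i else i == n)%N then Some (i - n + m)%N else None.

Lemma fac_pinverse b n m : pinverse (fac b n m) (fac b m n).
Proof.
by move=> i j; rewrite /fac; split; case: b; case: ifP => // h1 [<-];
  case: ifP => h2; try congr Some; lia.
Qed.

Lemma shiftN_pull : shiftN = pull (fac true 0 1) :> (l2 R nat -> _).
Proof.
apply/funext => f; apply: l2_inj => i; rewrite (pullE (@fac_pinverse true 0 1)).
by rewrite /fac /= subn0 addn1.
Qed.

Lemma proj0_pull : proj0 = pull (fac false 0 0) :> (l2 R nat -> _).
Proof.
apply/funext => f; apply: l2_inj => i; rewrite (pullE (@fac_pinverse false 0 0)).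
by rewrite /fac /=; case: ifP => //= /eqP ->.
Qed.

(** The hypothesis restricts to powers of [S] or of its adjoint; [fac true 1 1], for instance, is
    idempotent and violates the formula. *)
Lemma opow_fac (n m k : nat) : (n == 0)%N || (m == 0)%N ->
  opow (pull (fac true n m)) k = pull (fac true (n * k) (m * k)) :> (l2 R nat -> _).
Proof.
move=> nm; rewrite (opow_pull _ _ (@fac_pinverse true n m)); congr pull.
elim: k => [|k ih]; apply/funext => i /=.
  by rewrite /fac !muln0 /= subn0 addn0.
rewrite ih /pthen /fac /= !mulnS; 
have n0 : n = 0%N -> (n * k = 0)%N by move=> ->.
move: (n * k)%N (m * k)%N n0 => p q n0.
case: (leqP n i) => ni /=; last by case: ifP => //; lia.
by case: ifP => h; case: ifP => h' //; try congr Some; lia.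
Qed.

Lemma SS_pull n m : SS n m = pull (fac true n m) :> (l2 R nat -> _).
Proof.
rewrite /SS shiftN_pull (adj_pull R (@fac_pinverse true 0 1)) !opow_fac //.
rewrite !mul0n !mul1n (pull_comp R (@fac_pinverse true _ _) (@fac_pinverse true _ _)).
congr pull; apply/funext => i; rewrite /pthen /fac /=; case: ifP => //= _.
by congr Some; lia.
Qed.

Lemma SpS_pull n m : SpS n m = pull (fac false n m) :> (l2 R nat -> _).
Proof.
rewrite /SpS shiftN_pull proj0_pull (adj_pull R (@fac_pinverse true 0 1)) !opow_fac //.
rewrite !mul0n !mul1n (pull_comp R (@fac_pinverse true n 0) (@fac_pinverse false 0 0)).
have ss := pinverse_comp (@fac_pinverse true n 0) (@fac_pinverse false 0 0).
rewrite (pull_comp R ss (@fac_pinverse true 0 m)).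
congr pull; apply/funext => i; rewrite /pthen /fac /=.
case: leqP => /= [ni|]; last by case: eqP => //; lia.
by case: ifP => h; case: ifP => h1 //=; [congr Some|..]; lia.
Qed.

Definition trans (r l : int) : option int := Some (l + r).

Lemma trans_pinverse r : pinverse (trans r) (trans (- r)).
Proof. by move=> x y; rewrite /trans; split=> -[<-]; congr Some; lia. Qed.

Lemma shiftZ_pow_pull r : shiftZ_pow r = pull (trans r) :> (l2 R int -> _).
Proof.
have e : @shiftZ R = pull (trans 1).
  by apply/funext => f; apply: l2_inj => i; rewrite (pullE (trans_pinverse 1)).
have h q n : opow (pull (trans q)) n = pull (trans (q * n%:Z)) :> (l2 R int -> _).
  rewrite (opow_pull _ _ (trans_pinverse q)); congr pull.
  elim: n => [|n ih]; apply/funext => l; rewrite /trans ?mulr0 ?addr0 //=.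
  by rewrite ih /pthen /trans /=; congr Some; nia.
rewrite /shiftZ_pow e (adj_pull R (trans_pinverse 1)) !h.
by case: ifP => r0; congr (pull (trans _)); lia.
Qed.

Definition tens (s t : nat -> option nat) (u : int -> option int)
    (x : nat * nat * int) : option (nat * nat * int) :=
  obind (fun i => obind (fun j => omap (fun l => (i, j, l)) (u x.2)) (t x.1.2))
    (s x.1.1).

Lemma tensP s t u x i j l : tens s t u x = Some (i, j, l) <->
  [/\ s x.1.1 = Some i, t x.1.2 = Some j & u x.2 = Some l].
Proof.
rewrite /tens; case: (s _) => [i'|] /=; last by split=> // -[].
case: (t _) => [j'|] /=; last by split=> // -[].
case: (u _) => [l'|] /=; last by split=> // -[].
by split=> [[-> -> ->]|[[->] [->] [->]]].
Qed.

Lemma tens_pinverse s s' t t' u u' : pinverse s s' -> pinverse t t' -> pinverse u u' ->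
  pinverse (tens s t u) (tens s' t' u').
Proof.
move=> ss tt uu [[i j] l] [[i' j'] l']; rewrite !tensP /=.
by split=> -[/ss-> /tt-> /uu->].
Qed.

(** [tensor] wraps every intermediate slice in [to_l2], and the work is to see that none falls to
    the default: once the inner factors are evaluated at a point, what remains is either zero or the
    restriction of [f] to a coordinate line. *)
Lemma tensor_pull s s' t t' u u' : pinverse s s' -> pinverse t t' -> pinverse u u' ->
  tensor (pull s) (pull t) (pull u) = pull (tens s t u) :> op R.
Proof.
move=> ss tt uu; apply/funext => f; apply: l2_inj => -[[i j] l].
rewrite [RHS](pullE (tens_pinverse ss tt uu) f) /tensor.
have slice3 a b : to_l2 (fun l => f (a, b, l)) =1 (fun l => f (a, b, l)).
  apply: to_l2E.
  by apply: (@sqsummable_pull R _ _ predT (fun l => (a, b, l)) f _ (l2P f)) => ? ? _ _ [].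
have in3 a b k : pull u (to_l2 (fun l => f (a, b, l))) k =
    oapp (fun l => f (a, b, l)) 0 (u k).
  by rewrite (pullE uu); case: (u k) => //= c; rewrite slice3.
have slice2 a k : to_l2 (fun b => pull u (to_l2 (fun l => f (a, b, l))) k)
    =1 (fun b => oapp (fun l => f (a, b, l)) 0 (u k)).
  under [X in to_l2 X]funext => b do rewrite in3.
  apply: to_l2E; case: (u k) => [c|] /=; last exact: sqsummable0.
  by apply: (@sqsummable_pull R _ _ predT (fun b => (a, b, c)) f _ (l2P f)) => ? ? _ _ [].
have in2 a b k : pull t (to_l2 (fun b => pull u (to_l2 (fun l => f (a, b, l))) k)) b =
    oapp (fun b' => oapp (fun l => f (a, b', l)) 0 (u k)) 0 (t b).
  by rewrite (pullE tt); case: (t b) => //= c; rewrite slice2.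
have slice1 b k : to_l2 (fun a => pull t (to_l2 (fun b =>
      pull u (to_l2 (fun l => f (a, b, l))) k)) b) =1
    (fun a => oapp (fun b' => oapp (fun l => f (a, b', l)) 0 (u k)) 0 (t b)).
  under [X in to_l2 X]funext => a do rewrite in2.
  apply: to_l2E; case: (t b) => [c|] /=; last exact: sqsummable0.
  case: (u k) => [d|] /=; last exact: sqsummable0.
  by apply: (@sqsummable_pull R _ _ predT (fun a => (a, c, d)) f _ (l2P f)) => ? ? _ _ [].
have in1 x : pull s (to_l2 (fun a => pull t (to_l2 (fun b =>
      pull u (to_l2 (fun l => f (a, b, l))) x.2)) x.1.2)) x.1.1 =
    oapp f 0 (tens s t u x).
  rewrite (pullE ss) /tens; case: (s _) => //= a; rewrite slice1.
  by case: (t _) => //= b; case: (u _).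
rewrite -[RHS]in1 to_l2E //.
under [X in sqsummable X]funext => x do rewrite in1.
have := l2P (pull (tens s t u) f).
by under [X in sqsummable X]funext => x do rewrite (pullE (tens_pinverse ss tt uu)).
Qed.

End Factors.

(** * Parameters for the nonzero elements of T *)

(** The flags tell whether a factor lives on a half-line or at a point, so one record covers the
    families [B1] to [B4]. *)
Record code := Code {
  ray1 : bool; ray2 : bool;
  src1 : nat; src2 : nat; tgt1 : nat; tgt2 : nat; deg : int }.

(** With two rays the inequalities hold both ways and force equal coordinates, as in [B1]; without
    rays nothing is imposed, as in [B4]. *)
Definition valid (c : code) : Prop :=
  (ray1 c -> [/\ deg c = (tgt1 c)%:Z - (src1 c)%:Z,
                 (src2 c <= src1 c)%N & (tgt2 c <= tgt1 c)%N]) /\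
  (ray2 c -> [/\ deg c = (tgt2 c)%:Z - (src2 c)%:Z,
                 (src1 c <= src2 c)%N & (tgt1 c <= tgt2 c)%N]).

Definition pmap_of (c : code) : nat * nat * int -> option (nat * nat * int) :=
  tens (fac (ray1 c) (src1 c) (tgt1 c)) (fac (ray2 c) (src2 c) (tgt2 c))
    (trans (deg c)).

Definition flip (c : code) : code :=
  Code (ray1 c) (ray2 c) (tgt1 c) (tgt2 c) (src1 c) (src2 c) (- deg c).

Lemma valid_flip c : valid c -> valid (flip c).
Proof.
case: c => b1 b2 n1 n2 m1 m2 r [/= h1 h2].
by split=> /= [/h1|/h2] [-> ? ?]; split=> //; lia.
Qed.

Lemma pmap_of_pinverse c : pinverse (pmap_of c) (pmap_of (flip c)).
Proof. by apply: tens_pinverse; [exact: fac_pinverse|exact: fac_pinverse|exact: trans_pinverse]. Qed.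

(** The bicyclic multiplication rule in each coordinate; of the two truncated differences at least
    one vanishes. *)
Definition cprod (c d : code) : code :=
  Code (ray1 c && ray1 d) (ray2 c && ray2 d)
    (src1 c + (src1 d - tgt1 c)) (src2 c + (src2 d - tgt2 c))
    (tgt1 d + (tgt1 c - src1 d)) (tgt2 d + (tgt2 c - src2 d)) (deg c + deg d).

(** The hypothesis says that the image of the first map, which is the point [m] or the half-line
    from [m], meets the domain of the second. *)
Lemma fac_comp b n m b' n' m' : (b || (n' <= m)%N) && (b' || (m <= n')%N) ->
  pthen (fac b n m) (fac b' n' m') = fac (b && b') (n + (n' - m)) (m' + (m - n')).
Proof.
move=> h; apply/funext => i; rewrite /pthen /fac.
case: b b' h => -[] /= h; case: ifP => h1 //=; case: ifP => h2 //;
  try case: ifP => h3 //; try congr Some; lia.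
Qed.

Lemma fac_comp0 b n m b' n' m' : ~~ ((b || (n' <= m)%N) && (b' || (m <= n')%N)) ->
  pthen (fac b n m) (fac b' n' m') = fun=> None.
Proof.
move=> h; apply/funext => i; rewrite /pthen /fac.
by case: b b' h => -[] /= h; case: ifP => h1 //=; case: ifP => h2 //; lia.
Qed.

Lemma tens_comp s t u s' t' u' :
  pthen (tens s t u) (tens s' t' u') = tens (pthen s s') (pthen t t') (pthen u u').
Proof.
apply/funext => -[[i j] l]; rewrite /pthen /tens /=.
by case: (s i) => //= a; case: (t j) => [b|] /=; case: (u l) => [c|] //=;
  case: (s' a) => //= a'; case: (t' _).
Qed.

Lemma pmap_of_comp c d : valid c -> valid d ->
  pthen (pmap_of c) (pmap_of d) = (fun=> None) \/
  valid (cprod c d) /\ pthen (pmap_of c) (pmap_of d) = pmap_of (cprod c d).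
Proof.
move=> vc vd; rewrite /pmap_of tens_comp.
set P1 := (ray1 c || (src1 d <= tgt1 c)%N) && (ray1 d || (tgt1 c <= src1 d)%N).
set P2 := (ray2 c || (src2 d <= tgt2 c)%N) && (ray2 d || (tgt2 c <= src2 d)%N).
case: (boolP P1) => [h1|/fac_comp0 ->]; last by left; apply/funext => x.
case: (boolP P2) => [h2|/fac_comp0 ->]; last first.
  by left; apply/funext => x; rewrite /tens /=; case: (pthen _ _ _).
right; rewrite !fac_comp //; split; last first.
  congr tens; apply/funext => l; rewrite /pthen /trans /=; congr Some; lia.
rewrite {}/P1 {}/P2 in h1 h2; case: c d vc vd h1 h2
  => [b1 b2 n1 n2 m1 m2 r] [b1' b2' n1' n2' m1' m2' r'] [/= c1 c2] [/= d1 d2].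
(* A ray in the product comes from rays in both factors, so the degree identities add; where the
   other coordinate of the product is a point, the nonvanishing condition there helps to compare the
   coordinates. *)
case: b1 c1 => c1; case: b2 c2 => c2; case: b1' d1 => d1; case: b2' d2 => d2 /=;
  rewrite ?andbT ?orbT => h1 h2;
  try have [? ? ?] := c1 isT; try have [? ? ?] := c2 isT;
  try have [? ? ?] := d1 isT; try have [? ? ?] := d2 isT;
  by split=> //= _; split; lia.
Qed.

Definition Tmap (s : X -> option X) : Prop :=
  s = (fun=> None) \/ exists2 c, valid c & s = pmap_of c.

Lemma none_pinverse : pinverse (fun=> None : option X) (fun=> None).
Proof. by []. Qed.

Lemma Tmap_pinverse s : Tmap s -> exists2 t, Tmap t & pinverse s t.
Proof.
case=> [->|[c vc ->]]; first by exists (fun=> None) => //; left.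
exists (pmap_of (flip c)); last exact: pmap_of_pinverse.
by right; exists (flip c) => //; exact: valid_flip.
Qed.

Lemma Tmap_comp s t : Tmap s -> Tmap t -> Tmap (pthen s t).
Proof.
case=> [->|[c vc ->]]; first by left.
case=> [->|[d vd ->]].
  by left; apply/funext => x; rewrite /pthen; case: (pmap_of c x).
case: (pmap_of_comp vc vd) => [->|[vcd ->]]; first by left.
by right; exists (cprod c d).
Qed.

Lemma pinverse_injl (s t t' : X -> option X) :
  pinverse s t -> pinverse s t' -> t = t'.
Proof.
move=> st st'; apply/funext => y; case ty: (t y) => [x|].
  by move/st/st': ty.
by case ty': (t' y) => [x|] //; move/st'/st: ty'; rewrite ty.
Qed.

Definition diag (d : X -> bool) (x : X) : option X := if d x then Some x else None.

Lemma diag_pinverse d : pinverse (diag d) (diag d).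
Proof. by move=> x y; rewrite /diag; split; case: ifP => // h [e]; rewrite -e h. Qed.

(** * The semigroup T and its projections as partial injections *)

Section SemigroupT.
Context (R : realType).

Lemma tensor_fac b1 b2 n1 n2 m1 m2 r :
  tensor (pull (fac b1 n1 m1)) (pull (fac b2 n2 m2)) (shiftZ_pow r) =
  pull (pmap_of (Code b1 b2 n1 n2 m1 m2 r)) :> op R.
Proof.
rewrite shiftZ_pow_pull.
exact: (tensor_pull R (@fac_pinverse _ _ _) (@fac_pinverse _ _ _) (trans_pinverse r)).
Qed.

Lemma B1E r n m :
  B1 R r n m = pull (pmap_of (Code true true n.1 n.1 m.1 m.1 r)).
Proof. by rewrite /B1 SS_pull tensor_fac. Qed.

Lemma B2E r n m :
  B2 R r n m = pull (pmap_of (Code true false n.1 n.2 m.1 m.2 r)).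
Proof. by rewrite /B2 SS_pull SpS_pull tensor_fac. Qed.

Lemma B3E r n m :
  B3 R r n m = pull (pmap_of (Code false true n.1 n.2 m.1 m.2 r)).
Proof. by rewrite /B3 SS_pull SpS_pull tensor_fac. Qed.

Lemma B4E r n m :
  B4 R r n m = pull (pmap_of (Code false false n.1 n.2 m.1 m.2 r)).
Proof. by rewrite /B4 !SpS_pull tensor_fac. Qed.

Lemma zero_opE : zero_op R = pull (fun=> None).
Proof.
apply/funext => f; apply: l2_inj => x.
by rewrite [RHS](pullE none_pinverse).
Qed.

Lemma T_pull s : Tmap s -> T (pull s : op R).
Proof.
case=> [->|[[b1 b2 n1 n2 m1 m2 r] [/= h1 h2] ->]].
  by do 4 left; rewrite /= zero_opE.
case: b1 h1 => [/(_ isT)[r1 n12 m12]|_].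
  case: b2 h2 => [/(_ isT)[r2 n21 m21]|_].
    have [en em] : n2 = n1 /\ m2 = m1 by split; lia.
    do 3 left; right; exists r, (n1, n2), (m1, m2).
    by rewrite B1E en em.
  by do 2 left; right; exists r, (n1, n2), (m1, m2); rewrite B2E.
case: b2 h2 => [/(_ isT)[r2 n21 m21]|_].
  by left; right; exists r, (n1, n2), (m1, m2); rewrite B3E.
by right; exists r, (n1, n2), (m1, m2); rewrite B4E.
Qed.

Lemma T_pullP (a : op R) : T a -> exists2 s, Tmap s & a = pull s.
Proof.
case=> [[[[->|]|]|]|].
- by exists (fun=> None); [left|exact: zero_opE].
- move=> [r [[n1 n2] [[m1 m2]]]] [/= -> -> rE ->]; rewrite B1E; eexists => //.
  by right; eexists => //; split=> /= _; split; lia.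
- move=> [r [[n1 n2] [[m1 m2]]]] [/= rE h h' ->]; rewrite B2E; eexists => //.
  by right; eexists => //; split=> //= _; split; lia.
- move=> [r [[n1 n2] [[m1 m2]]]] [/= rE h h' ->]; rewrite B3E; eexists => //.
  by right; eexists => //; split=> //= _; split; lia.
- move=> [r [n [m ->]]]; rewrite B4E; eexists => //.
  by right; eexists => //; split.
Qed.

(* The partial injection of which [a] is the pullback (junk for [a] outside T). *)
Definition pmap_op (a : op R) : X -> option X :=
  xget (fun=> None) [set s | Tmap s /\ a = pull s].

Lemma pmap_opP (a : op R) : T a -> Tmap (pmap_op a) /\ a = pull (pmap_op a).
Proof.
case/T_pullP => s Ts ->; rewrite /pmap_op.
by case: xgetP => [t -> //|/(_ s)[]].
Qed.

Lemma pmap_op_pull (s : X -> option X) : Tmap s -> pmap_op (pull s) = s.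
Proof.
move=> Ts; have [Tt e] := pmap_opP (T_pull Ts).
have [s' _ ss] := Tmap_pinverse Ts; have [t' _ tt] := Tmap_pinverse Tt.
by rewrite -(pull_inj ss tt e).
Qed.

Lemma pmap_op_inj (a b : op R) : T a -> T b -> pmap_op a = pmap_op b -> a = b.
Proof. by move=> /pmap_opP[_ ea] /pmap_opP[_ eb] e; rewrite ea e -eb. Qed.

Lemma T_mul (a b : op R) : T a -> T b -> T (a ** b).
Proof.
move=> /T_pullP[s Ts ->] /T_pullP[t Tt ->].
have [s' _ ss] := Tmap_pinverse Ts; have [t' _ tt] := Tmap_pinverse Tt.
by rewrite /omul (pull_comp R ss tt); apply/T_pull/Tmap_comp.
Qed.

Lemma pmap_op_mul (a b : op R) : T a -> T b ->
  pmap_op (a ** b) = pthen (pmap_op a) (pmap_op b).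
Proof.
move=> /T_pullP[s Ts ->] /T_pullP[t Tt ->].
have [s' _ ss] := Tmap_pinverse Ts; have [t' _ tt] := Tmap_pinverse Tt.
rewrite /omul (pull_comp R ss tt) !pmap_op_pull //; exact: Tmap_comp.
Qed.

Lemma T_adj (a : op R) : T a -> T (adj a).
Proof.
move=> /T_pullP[s Ts ->]; have [t Tt st] := Tmap_pinverse Ts.
by rewrite (adj_pull R st); exact: T_pull.
Qed.

Lemma pmap_op_adj (a : op R) : T a -> pinverse (pmap_op a) (pmap_op (adj a)).
Proof.
move=> /T_pullP[s Ts ->]; have [t Tt st] := Tmap_pinverse Ts.
by rewrite (adj_pull R st) !pmap_op_pull.
Qed.

Lemma pmap_op0 : pmap_op (zero_op R) = fun=> None.
Proof. by rewrite zero_opE pmap_op_pull //; left. Qed.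

Lemma E_inj (e f : E R) : E_op e = E_op f -> e = f.
Proof.
case: e f => [a Ta ia sa] [b Tb ib sb] /= ab; case: _ / ab Tb ib sb => Tb ib sb.
by congr MkE; exact: Prop_irrelevance.
Qed.

(** An idempotent map fixes its image pointwise, and injectivity then identifies [x] with its
    image. *)
Lemma pmap_op_E (e : E R) x y : pmap_op e x = Some y -> x = y.
Proof.
have Te := E_T e; have inv := pmap_op_adj Te.
have i : pthen (pmap_op e) (pmap_op e) = pmap_op e.
  by rewrite -pmap_op_mul // E_idem.
move=> xy; have : pthen (pmap_op e) (pmap_op e) x = Some y by rewrite i.
case/pthenP => z xz zy; move: xz; rewrite xy => -[yz]; rewrite -yz in zy.
by move/inv: xy; move/inv: zy => -> [].
Qed.

Definition dom (a : op R) (x : X) : bool := pmap_op a x.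

Lemma pmap_op_diag (e : E R) : pmap_op e = diag (dom e).
Proof.
apply/funext => x; rewrite /diag /dom.
by case ex: (pmap_op e x) => [y|] //=; rewrite (pmap_op_E ex).
Qed.

(** Supplies the elements of [E] that [ev] requires at products of projections, at [s ** adj s] and
    at [s ** e ** adj s]. *)
Lemma E_of_diag (a : op R) : T a -> (forall x y, pmap_op a x = Some y -> x = y) ->
  exists e : E R, E_op e = a.
Proof.
move=> Ta ha.
have aE : pmap_op a = diag (dom a).
  apply/funext => x; rewrite /diag /dom.
  by case ex: (pmap_op a x) => [y|] //=; rewrite (ha _ _ ex).
have ai : a ** a = a.
  apply: (pmap_op_inj (T_mul Ta Ta) Ta).
  rewrite (pmap_op_mul Ta Ta) aE; apply/funext => x.
  by rewrite /pthen /diag; case: ifP => //= ->.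
have aa : adj a = a.
  apply: (pmap_op_inj (T_adj Ta) Ta).
  apply: (pinverse_injl (pmap_op_adj Ta)).
  rewrite aE; exact: diag_pinverse.
by exists (MkE Ta ai aa).
Qed.

Lemma dom_mul (a b : op R) x : T a -> T b ->
  dom (a ** b) x <-> exists2 y, pmap_op a x = Some y & dom b y.
Proof.
move=> Ta Tb; rewrite /dom (pmap_op_mul Ta Tb) /pthen.
case: (pmap_op a x) => [y|] /=; last by split=> // -[].
by split=> [h|[z [<-]] //]; exists y.
Qed.

Lemma dom_adj (a : op R) x y : T a -> pmap_op a x = Some y -> dom (adj a) y.
Proof. by move=> /pmap_op_adj h /h; rewrite /dom => ->. Qed.

Lemma E_mul (e f : E R) : exists g : E R, E_op g = e ** f.
Proof.
apply: E_of_diag; first exact: T_mul (E_T e) (E_T f).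
move=> x y; rewrite (pmap_op_mul (E_T e) (E_T f)) => /pthenP[z].
by move=> /pmap_op_E -> /pmap_op_E.
Qed.

Lemma dom_mulE (e f : E R) x : dom (e ** f) x = dom e x && dom f x.
Proof.
rewrite /dom (pmap_op_mul (E_T e) (E_T f)) /pthen.
by case ex: (pmap_op e x) => [y|] //=; rewrite (pmap_op_E ex).
Qed.

(** Conjugation is preimage along [s]; this turns the action on characters into transport of
    neighbourhoods. *)
Lemma dom_conj (s : op R) (e : E R) x : T s ->
  dom (s ** e ** adj s) x <-> exists2 y, pmap_op s x = Some y & dom e y.
Proof.
move=> Ts; have Te := E_T e; rewrite (dom_mul _ (T_mul Ts Te) (T_adj Ts)).
rewrite (pmap_op_mul Ts Te); split=> [[z /pthenP[y sx ey] _]|[y sx dy]].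
  by exists y => //; rewrite /dom ey.
exists y; last exact: dom_adj sx.
by apply/pthenP; exists y => //; rewrite pmap_op_diag /diag dy.
Qed.

Lemma E_conj (s : op R) (e : E R) : T s -> exists g : E R, E_op g = s ** e ** adj s.
Proof.
move=> Ts; have Te := E_T e; have Tse := T_mul Ts Te; have Ta := T_adj Ts.
apply: E_of_diag; first exact: T_mul.
move=> x y; rewrite (pmap_op_mul Tse Ta) (pmap_op_mul Ts Te).
move=> /pthenP[z /pthenP[w xw wz] zy].
by move/pmap_op_E: wz zy => <-; move/(pmap_op_adj Ts): xw => -> [].
Qed.

Lemma E_range (s : op R) : T s -> exists g : E R, E_op g = s ** adj s.
Proof.
move=> Ts; apply: E_of_diag; first exact: T_mul (T_adj Ts).
move=> x y; rewrite (pmap_op_mul Ts (T_adj Ts)) => /pthenP[z xz zy].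
by move: zy; move/(pmap_op_adj Ts): xz => -> [].
Qed.

Lemma dom_range (s : op R) x : T s -> dom (s ** adj s) x = dom s x.
Proof.
move=> Ts; apply/idP/idP => [|].
  by move=> /(dom_mul _ Ts (T_adj Ts))[y]; rewrite /dom => ->.
rewrite /dom; case sx: (pmap_op s x) => [y|] // _.
apply/(dom_mul _ Ts (T_adj Ts)); exists y => //; exact: dom_adj sx.
Qed.

Lemma evE (x : E R -> bool) (e : E R) : ev x e = x e.
Proof.
apply/asboolP/idP => [[f /E_inj ->]|xe] //; by exists e.
Qed.

End SemigroupT.

(** * Ends of N x N and the behaviour of partial injections near them *)

Definition cell1 (L : nat) (k : option nat) (i : nat) : bool :=
  if k is Some k then i == k else (L <= i)%N.

(** Basic neighbourhoods of the end [K]. The Z-coordinate stays free because no projection in [E]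
    restricts it. *)
Definition cell (L : nat) (K : idx) (x : X) : bool :=
  cell1 L K.1 x.1.1 && cell1 L K.2 x.1.2.

Definition corner (L : nat) (K : idx) : X := (odflt L K.1, odflt L K.2, 0).

Lemma cell_corner L K : cell L K (corner L K).
Proof. by case: K => [[?|] [?|]]; rewrite /cell /= ?eqxx ?leqnn. Qed.

Lemma cell_le L L' K x : (L <= L')%N -> cell L' K x -> cell L K x.
Proof.
move=> LL /andP[h1 h2]; apply/andP; move: h1 h2.
by case: K => [[?|] [?|]] /=; split=> //; apply: leq_trans LL _.
Qed.

Definition near_end (K : idx) (P : X -> Prop) : Prop :=
  exists L, forall x, cell L K x -> P x.

Lemma nearS K (P Q : X -> Prop) : near_end K P -> (forall x, P x -> Q x) -> near_end K Q.
Proof. by case=> L h PQ; exists L => x /h /PQ. Qed.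

Lemma near_and K (P Q : X -> Prop) :
  near_end K P -> near_end K Q -> near_end K (fun x => P x /\ Q x).
Proof.
move=> [L h] [L' h']; exists (maxn L L') => x c; split; [apply: h|apply: h'].
- by apply: cell_le c; exact: leq_maxl.
- by apply: cell_le c; exact: leq_maxr.
Qed.

Lemma near_ex K (P : X -> Prop) L :
  near_end K P -> exists L', (L <= L')%N /\ P (corner L' K).
Proof.
case=> L' h; exists (maxn L L'); split; first exact: leq_maxl.
by apply: h; apply: (@cell_le _ (maxn L L')); rewrite ?cell_corner ?leq_maxr.
Qed.

Definition same (K M : idx) : Prop :=
  isSome K.1 = isSome M.1 /\ isSome K.2 = isSome M.2.

Lemma same_sym K M : same K M -> same M K.
Proof. by case. Qed.

Lemma same_trans K M N : same K M -> same M N -> same K N.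
Proof. by move=> [h1 h2] [h3 h4]; split; [rewrite h1|rewrite h2]. Qed.

(** At a finite coordinate a cell has a single position, so a constant suffices; at an infinite one
    [absz] is the true translation as soon as [i + r] is nonnegative. *)
Definition slide1 (m : option nat) (r : int) (i : nat) : nat :=
  if m is Some m then m else absz (i%:Z + r).

(* The translation carrying the far part of [cell _ K] onto that of [cell _ M]. *)
Definition slide (M : idx) (r : int) (x : X) : X :=
  (slide1 M.1 r x.1.1, slide1 M.2 r x.1.2, x.2 + r).

Lemma cell_slide K M r L x : same K M ->
  cell (L + `|r|)%N K x -> cell L M (slide M r x).
Proof.
case: K M x => [[k1|] [k2|]] [[m1|] [m2|]] [[i j] l] [] //= _ _;
  rewrite /cell /= => /andP[h1 h2]; rewrite ?eqxx //=; lia.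
Qed.

Lemma near_slide K M r P : same K M -> near_end M P -> near_end K (fun x => P (slide M r x)).
Proof.
by move=> KM [L h]; exists (L + `|r|)%N => x /(cell_slide KM) /h.
Qed.

Lemma slideK K M r : same K M -> near_end M (fun x => slide M r (slide K (- r) x) = x).
Proof.
move=> KM; exists `|r|%N.
case: K M KM => [[k1|] [k2|]] [[m1|] [m2|]] [] //= _ _ [[i j] l];
  rewrite /cell /slide /= => /andP[h1 h2]; congr (_, _, _); lia.
Qed.

Lemma slideD K M N r r' : same K M -> same M N ->
  near_end K (fun x => slide N r' (slide M r x) = slide N (r + r') x).
Proof.
move=> KM MN; exists (`|r| + `|r'|)%N.
case: K M N KM MN => [[k1|] [k2|]] [[m1|] [m2|]] [[n1|] [n2|]] [] //= _ _ [] //= _ _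
  [[i j] l]; rewrite /cell /slide /= => /andP[h1 h2]; congr (_, _, _); lia.
Qed.

(** One common point suffices: its Z-coordinate records the degree, and the finite coordinates of
    its image are those of the target end. *)
Lemma slide_inj K M M' r r' : same K M -> same K M' ->
  near_end K (fun x => slide M r x = slide M' r' x) -> M = M' /\ r = r'.
Proof.
move=> KM KM' /(@near_ex _ _ 0)[L [_]].
case: K M M' KM KM' => [[k1|] [k2|]] [[m1|] [m2|]] [[n1|] [n2|]] [] //= _ _ [] //= _ _;
  rewrite /slide /= => -[] e1 e2 e3; (split; last by lia).
- by rewrite e1 e2.
- by rewrite e1.
- by rewrite e2.
- by [].
Qed.

Definition moves (K M : idx) (r : int) (s : X -> option X) : Prop :=
  same K M /\ near_end K (fun x => s x = Some (slide M r x)).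

Lemma moves_inverse K M r s t : moves K M r s -> pinverse s t -> moves M K (- r) t.
Proof.
move=> [KM h] st; split; first exact: same_sym.
have h' := near_slide (- r) (same_sym KM) h.
apply: (nearS (near_and h' (slideK r KM))) => x [/= sx mx].
by apply/st; rewrite sx mx.
Qed.

Lemma moves_comp K M N r r' s t : moves K M r s -> moves M N r' t ->
  moves K N (r + r') (pthen s t).
Proof.
move=> [KM h] [MN h']; split; first exact: same_trans MN.
apply: (nearS (near_and h (near_and (near_slide r KM h') (slideD r r' KM MN)))).
by move=> x [/= sx [tx mx]]; rewrite /pthen sx /= tx mx.
Qed.

Lemma moves_inj K M M' r r' s : moves K M r s -> moves K M' r' s ->
  M = M' /\ r = r'.
Proof.
move=> [KM h] [KM' h']; apply: (slide_inj KM KM').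
by apply: (nearS (near_and h h')) => x [/= -> /Some_inj].
Qed.

Lemma moves_ext K M r s t : moves K M r s -> near_end K (fun x => s x = t x) ->
  moves K M r t.
Proof.
move=> [KM h] st; split => //.
by apply: (nearS (near_and h st)) => x [/= sx <-].
Qed.

(** Sliding back by [- r] inverts [s] near [K], so [s] matches the neighbourhoods of [K] with those
    of [M]. *)
Lemma near_moves K M r s (P : X -> Prop) : moves K M r s ->
  near_end M P <-> near_end K (fun x => exists2 y, s x = Some y & P y).
Proof.
move=> [KM h]; split=> [MP|KP].
  apply: (nearS (near_and h (near_slide r KM MP))) => x [/= sx px].
  by exists (slide M r x).
have h2 := near_slide (- r) (same_sym KM) (near_and h KP).
apply: (nearS (near_and h2 (slideK r KM))) => x /= [[-> [y [<-] py]] e].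
by rewrite -e.
Qed.

(** Tailored to the displayed representatives: points sit at finite coordinates and half-lines run
    to infinite ones, although a half-line also contains finite positions. *)
Definition fits (b : bool) (n m : nat) (k k' : option nat) : Prop :=
  match k, k' with
  | Some k, Some k' => [/\ b = false, n = k & m = k']
  | None, None => b
  | _, _ => False
  end.

Lemma moves_code c K M : valid c ->
  fits (ray1 c) (src1 c) (tgt1 c) K.1 M.1 ->
  fits (ray2 c) (src2 c) (tgt2 c) K.2 M.2 -> moves K M (deg c) (pmap_of c).
Proof.
case: c => b1 b2 n1 n2 m1 m2 r [/= v1 v2] f1 f2; split.
  by case: K M f1 f2 => [[?|] [?|]] [[?|] [?|]].
exists (n1 + n2 + `|r|)%N => -[[i j] l] /andP[] /=.
move=> h1 h2; rewrite /slide /=; apply/tensP => /=.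
rewrite /fac /trans; split=> //.
  case: K M {f2 h2} f1 h1 => [[k|] ?] [[m|] ?] //= => [[-> -> ->] /eqP ->|b1T Li].
    by rewrite eqxx subnn.
  by have [? _ _] := v1 b1T; rewrite b1T ifT; [congr Some|]; lia.
case: K M {f1 h1} f2 h2 => [? [k|]] [? [m|]] //= => [[-> -> ->] /eqP ->|b2T Li].
  by rewrite eqxx subnn.
by have [? _ _] := v2 b2T; rewrite b2T ifT; [congr Some|]; lia.
Qed.

(** The strict bound [n < L] puts the point [n] outside the cell at infinity, so being defined there
    forces a half-line, whose translation length is [r]. *)
Lemma fac_slide1 (b : bool) n m r L k i : (b -> r = m%:Z - n%:Z) -> (n < L)%N ->
  cell1 L k i -> fac b n m i ->
  fac b n m i = Some (slide1 (omap (fun k => k - n + m)%N k) r i).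
Proof.
move=> br nL; rewrite /fac; case: k => [k|] /=.
  by move=> /eqP ->; case: ifP.
move=> Li; case: b br => [/(_ isT) ->|_]; case: ifP => // h _; congr Some; lia.
Qed.

Lemma Tmap_moves s K : Tmap s -> near_end K (fun x => s x) ->
  exists M r, moves K M r s.
Proof.
case=> [->|[c vc ->] [L h]]; first by case/(@near_ex _ _ 0) => L [_].
pose M := (omap (fun k => k - src1 c + tgt1 c)%N K.1,
           omap (fun k => k - src2 c + tgt2 c)%N K.2).
exists M, (deg c); split; first by case: K {h} @M => [[?|] [?|]].
(* The [+ 1] makes the threshold strictly larger than both sources, as [fac_slide1] demands. *)
exists (L + src1 c + src2 c + 1)%N => -[[i j] l] Kx.
have {}h : pmap_of c (i, j, l).
  by apply/h/(cell_le _ Kx); rewrite -!addnA leq_addr.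
case: vc => v1 v2; case/andP: Kx => /= c1 c2.
case e: (pmap_of c (i, j, l)) h => [[[i' j'] l']|] // _.
case/tensP: e => /= e1 e2 [<-].
have s1 := @fac_slide1 _ (src1 c) (tgt1 c) (deg c) _ _ _ _ _ c1.
have s2 := @fac_slide1 _ (src2 c) (tgt2 c) (deg c) _ _ _ _ _ c2.
congr (Some (_, _, _)); apply: Some_inj; rewrite -?e1 -?e2.
- by apply: s1; [case/v1|lia|rewrite e1].
- by apply: s2; [case/v2|lia|rewrite e2].
Qed.

Lemma exists_moves K M r : same K M -> exists2 s, Tmap s & moves K M r s.
Proof.
move=> KM; case: K M KM => [[k1|] [k2|]] [[m1|] [m2|]] [] //= _ _.
- pose c := Code false false k1 k2 m1 m2 r.
  have vc : valid c by [].
  by exists (pmap_of c); [right; exists c|exact: (moves_code vc)].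
(* This [n] is large enough for [k1 <= n] and [m1 <= n + r], the two inequalities in [valid]. *)
- pose n := (k1 + m1 + `|r|)%N; pose m := absz (n%:Z + r).
  pose c := Code false true k1 n m1 m r.
  have vc : valid c by split=> //= _; rewrite /m /n; split; lia.
  by exists (pmap_of c); [right; exists c|exact: (moves_code vc)].
- pose n := (k2 + m2 + `|r|)%N; pose m := absz (n%:Z + r).
  pose c := Code true false n k2 m m2 r.
  have vc : valid c by split=> //= _; rewrite /m /n; split; lia.
  by exists (pmap_of c); [right; exists c|exact: (moves_code vc)].
- pose n := `|r|%N; pose m := absz (n%:Z + r).
  pose c := Code true true n n m m r.
  have vc : valid c by split=> //= _; rewrite /m /n; split; lia.
  by exists (pmap_of c); [right; exists c|exact: (moves_code vc)].
Qed.

(** For an end with one infinite coordinate this is the lower bound on l in [Lambda]; for a finite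
    end the cells do not depend on [L]. *)
Definition cutoff (K : idx) : nat := (odflt 0 K.1 + odflt 0 K.2)%N.

Lemma pmap_of_diag b1 b2 n1 n2 :
  pmap_of (Code b1 b2 n1 n2 n1 n2 0) =
  diag (fun x => (if b1 then n1 <= x.1.1 else x.1.1 == n1)%N
              && (if b2 then n2 <= x.1.2 else x.1.2 == n2)%N).
Proof.
apply/funext => -[[i j] l]; rewrite /pmap_of /tens /fac /trans /diag /= addr0.
have h (b : bool) (n k : nat) : (if b then n <= k else k == n)%N -> (k - n + n = k)%N.
  by case: b => [|/eqP ->]; lia.
move: (h b1 n1 i) (h b2 n2 j); case: (if b1 then _ else _) => //= /(_ isT) ->.
by case: (if b2 then _ else _) => //= /(_ isT) ->.
Qed.

Lemma diag_cell K L : (cutoff K <= L)%N -> exists2 c, valid c & diag (cell L K) = pmap_of c.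
Proof.
case: K => [[k1|] [k2|]]; rewrite /cutoff /= => KL.
- by exists (Code false false k1 k2 k1 k2 0) => //; rewrite pmap_of_diag.
- exists (Code false true k1 L k1 L 0); last by rewrite pmap_of_diag.
  by split=> //= _; split; lia.
- exists (Code true false L k2 L k2 0); last by rewrite pmap_of_diag.
  by split=> //= _; split; lia.
- exists (Code true true L L L L 0); last by rewrite pmap_of_diag.
  by split=> //= _; split; lia.
Qed.

Lemma Tmap_cell K L : (cutoff K <= L)%N -> Tmap (diag (cell L K)).
Proof. by move=> /diag_cell[c vc e]; right; exists c. Qed.

(** * The characters phi as neighbourhood filters of ends *)

Section Characters.
Context (R : realType).

Lemma LambdaP (K : idx) (a : op R) : Lambda K a <->
  exists2 L, (cutoff K <= L)%N & a = pull (diag (cell L K)).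
Proof.
case: K => [[k1|] [k2|]] /=; split.
- move=> ->; exists (k1 + k2)%N; first by rewrite /cutoff.
  by rewrite B4E pmap_of_diag.
- by move=> [L _ ->]; rewrite B4E pmap_of_diag.
- move=> [l /= kl <-]; exists l; first by rewrite /cutoff /= addn0.
  by rewrite B3E pmap_of_diag.
- rewrite /cutoff /= addn0 => -[L kL ->]; exists L => //.
  by rewrite B3E pmap_of_diag.
- move=> [l /= kl <-]; exists l; first by rewrite /cutoff.
  by rewrite B2E pmap_of_diag.
- move=> [L kL ->]; exists L => //.
  by rewrite B2E pmap_of_diag.
- move=> [l _ <-]; exists l; first by rewrite /cutoff.
  by rewrite B1E pmap_of_diag.
- move=> [L kL ->]; exists L => //.
  by rewrite B1E pmap_of_diag.
Qed.

Lemma E_cell K L : (cutoff K <= L)%N -> exists e : E R, dom e = cell L K.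
Proof.
move=> KL; have Tc := Tmap_cell KL.
have [|e eE] := @E_of_diag R (pull (diag (cell L K))) (T_pull R Tc).
  by move=> x y; rewrite pmap_op_pull // /diag; case: ifP => // _ [].
exists e; apply/funext => x; rewrite eE /dom pmap_op_pull // /diag.
by case: (cell L K x).
Qed.

(** The members of [Lambda K] project onto cells, and [e] absorbs such a projection exactly when its
    domain contains the cell. *)
Lemma phiP (K : idx) (e : E R) : phi R K e <-> near_end K (dom e).
Proof.
have h L : (cutoff K <= L)%N -> e ** pull (diag (cell L K)) = pull (diag (cell L K)) <->
    forall x, cell L K x -> dom e x.
  move=> KL; have Tc := Tmap_cell KL; have Ta := T_pull R Tc; have Te := E_T e.
  split=> [ea x Kx|sub].
    have := pmap_op_mul Te Ta; rewrite ea pmap_op_pull // pmap_op_diag.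
    by move=> /(congr1 (@^~ x)); rewrite /pthen /diag Kx; case: ifP.
  apply: (pmap_op_inj (T_mul Te Ta) Ta).
  rewrite pmap_op_mul // pmap_op_pull // pmap_op_diag; apply/funext => x.
  rewrite /pthen /diag; case Kx: (cell L K x); first by rewrite (sub _ Kx) /= Kx.
  by case: (dom e x) => //=; rewrite Kx.
split=> [/asboolP[a /LambdaP[L KL ->] /(h _ KL)]|]; first by exists L.
move=> [L sub]; apply/asboolP; set L' := maxn L (cutoff K).
have KL : (cutoff K <= L')%N by rewrite leq_maxr.
exists (pull (diag (cell L' K))); first by apply/LambdaP; exists L'.
apply/(h _ KL) => x /(cell_le _) c; apply/sub/c; exact: leq_maxl.
Qed.

Lemma ev_phi (K : idx) (a : op R) : (exists e : E R, E_op e = a) ->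
  ev (phi R K) a <-> near_end K (dom a).
Proof. by move=> [e <-]; rewrite evE; exact: phiP. Qed.

Lemma phi_hatE0 (K : idx) : hatE0 (phi R K).
Proof.
split.
- have [e eE] := E_cell (leqnn (cutoff K)).
  by exists e; apply/phiP; rewrite eE; exists (cutoff K).
- apply/negbTE/asboolP => -[e e0 /phiP/(@near_ex _ _ 0)[L [_]]].
  by rewrite e0 /dom pmap_op0.
- move=> e f; apply/idP/andP.
    move/(ev_phi _ (E_mul e f)) => h.
    by split; apply/phiP/(nearS h) => x; rewrite dom_mulE => /andP[].
  move=> [/phiP he /phiP hf]; apply/(ev_phi _ (E_mul e f)).
  by apply: (nearS (near_and he hf)) => x [ex fx]; rewrite dom_mulE ex.
Qed.

Lemma E_neq0 (e : E R) : E_op e <> zero_op R -> exists x, dom e x.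
Proof.
move=> e0; apply: contrapT => h; apply: e0.
have T0 : T (zero_op R) by rewrite zero_opE; apply: T_pull; left.
apply: (pmap_op_inj (E_T e) T0); rewrite pmap_op0 pmap_op_diag.
apply/funext => x; rewrite /diag; case: ifP => // ex.
by case: h; exists x.
Qed.

Lemma fac_cell1 (b : bool) n m L k i i' : (n < L)%N ->
  cell1 L k i -> cell1 L k i' -> fac b n m i -> fac b n m i'.
Proof.
move=> nL; case: k => [k|] /=; first by move=> /eqP -> /eqP ->.
by rewrite /fac; case: b => Li Li'; case: ifP => // h _; rewrite ?ifT //; lia.
Qed.

(** Domains of projections are products of points and half-lines, so far enough out a cell lies
    entirely inside or entirely outside. This is the dichotomy behind maximality of the filter. *)
Lemma near_end_frequently (K : idx) (e : E R) :
  (forall L, exists2 x, cell L K x & dom e x) -> near_end K (dom e).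
Proof.
have [+ _] := pmap_opP (E_T e); rewrite /dom; case=> [->|[c vc ->]] h.
  by have [] := h 0%N.
exists (src1 c + src2 c + 1)%N => -[[i' j'] l'] /andP[/= c1' c2'].
have [[[i j] l] /andP[/= c1 c2]] := h (src1 c + src2 c + 1)%N.
case e1: (pmap_of c _) => [[[a b] d]|] // _; case/tensP: e1 => /= f1 f2 _.
have f1' : fac (ray1 c) (src1 c) (tgt1 c) i'.
  by apply: (@fac_cell1 _ _ _ _ _ _ _ _ c1 c1'); [lia|rewrite f1].
have f2' : fac (ray2 c) (src2 c) (tgt2 c) j'.
  by apply: (@fac_cell1 _ _ _ _ _ _ _ _ c2 c2'); [lia|rewrite f2].
by rewrite /pmap_of /tens /=; case: (fac _ _ _ i') f1' => //= ? _;
  case: (fac _ _ _ j') f2'.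
Qed.

Lemma leE_dom (e f : E R) : leE e f -> forall x, dom e x -> dom f x.
Proof.
move=> ef x; rewrite -[in dom e x]ef dom_mulE; by case/andP.
Qed.

Lemma phi_filter (K : idx) : is_filter [set e | phi R K e].
Proof.
split.
- have [e eE] := E_cell (leqnn (cutoff K)).
  by exists e; apply/phiP; rewrite eE; exists (cutoff K).
- by move=> e /phiP/(@near_ex _ _ 0)[L [_ +]] e0; rewrite e0 /dom pmap_op0.
- by move=> e f /phiP h /leE_dom ef; apply/phiP/(nearS h).
- move=> e f /phiP he /phiP hf; have [g gE] := E_mul e f; exists g => //.
  apply/phiP/(nearS (near_and he hf)) => x [ex fx].
  by rewrite gE dom_mulE ex.
Qed.

(** A member of a larger filter has nonzero product with every cell projection, so its domain meets
    every cell and hence contains one. *)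
Lemma phi_ultrafilter (K : idx) : is_ultrafilter [set e | phi R K e].
Proof.
split; first exact: phi_filter.
move=> A [_ A0 _ AM] sub; apply/seteqP; split; last exact: sub.
move=> f Af; apply/phiP/near_end_frequently => L.
have KL : (cutoff K <= maxn L (cutoff K))%N by rewrite leq_maxr.
have [e eE] := E_cell KL.
have Ae : A e by apply: sub; apply/phiP; rewrite eE; exists (maxn L (cutoff K)).
have [g Ag gE] := AM _ _ Ae Af.
have [x] := E_neq0 (A0 _ Ag); rewrite gE dom_mulE eE => /andP[Kx fx].
by exists x => //; apply: (cell_le _ Kx); exact: leq_maxl.
Qed.

Lemma phi_tight (K : idx) : hatEtight (phi R K).
Proof.
split; last exact: phi_hatE0.
by apply: subset_closure; split; [exact: phi_hatE0|exact: phi_ultrafilter].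
Qed.

Lemma phi_sub_same (K M : idx) :
  (forall e, phi R M e -> phi R K e) -> forall L, exists L', forall x,
  cell L' K x -> cell L M x.
Proof.
move=> h L; have KL : (cutoff M <= maxn L (cutoff M))%N by rewrite leq_maxr.
have [e eE] := E_cell KL.
have /h/phiP[L' L'h] : phi R M e by apply/phiP; rewrite eE; exists (maxn L (cutoff M)).
exists L' => x /L'h; rewrite eE; apply: cell_le; exact: leq_maxl.
Qed.

Lemma phi_inj : injective (phi R).
Proof.
move=> K M KM.
(* At level [(cutoff K).+1] an infinite coordinate of [M] excludes the finite coordinate of [K] in
   the same position. *)
have [L1 /(_ _ (cell_corner _ _)) h1] := @phi_sub_same K M (fun e => etrans (congr1 (@^~ e) KM)) ((cutoff K).+1).
have [L2 /(_ _ (cell_corner _ _)) h2] := @phi_sub_same M K (fun e => etrans (congr1 (@^~ e) (esym KM))) ((cutoff M).+1).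
move: h1 h2; rewrite /cell /corner /cutoff.
by case: K M {KM} => [[k1|] [k2|]] [[m1|] [m2|]] //= /andP[h1 h2] /andP[h3 h4];
  rewrite ?(eqP h1) ?(eqP h2) //; lia.
Qed.

(** * Arrows between the characters phi: range, source, inverse and product *)

(* The arrow from [phi M] to [phi K] (source to range) of degree [r]. *)
Definition Arr (K M : idx) (r : int) : arrow R :=
  [set q | [/\ q.1 = phi R K, T q.2 & moves K M r (pmap_op q.2)]].

Lemma moves_dom K M r (s : op R) : moves K M r (pmap_op s) -> near_end K (dom s).
Proof. by move=> [_ h]; apply: (nearS h) => x; rewrite /dom => ->. Qed.

Lemma Sigma_phi K (s : op R) : Sigma (phi R K, s) <-> T s /\ near_end K (dom s).
Proof.
split=> [[/= Ts [_ h]]|[Ts h]].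
  split=> //; move: h => /(ev_phi _ (E_range Ts)) h.
  by apply: (nearS h) => x; rewrite dom_range.
split=> //; split; first exact: phi_hatE0.
by apply/(ev_phi _ (E_range Ts))/(nearS h) => x; rewrite dom_range.
Qed.

(** Multiplying by [e] with [phi K e] restricts to a neighbourhood of [K], so a germ remembers
    precisely the motion near [K]. *)
Lemma germ_phi K M r (s : op R) : T s -> moves K M r (pmap_op s) ->
  germ (phi R K) s = Arr K M r.
Proof.
move=> Ts ms; apply/seteqP; split=> -[x t].
  move=> [[/= Tt _] [/= <- [e /phiP he]]] est; split => //=.
  apply: (moves_ext ms); apply: (nearS he) => y ey.
  have := congr1 (@pmap_op R) est => /=.
  rewrite (pmap_op_mul (E_T e) Ts) (pmap_op_mul (E_T e) Tt).
  by move=> /(congr1 (@^~ y)); rewrite /pthen pmap_op_diag /diag ey.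
move=> [/= -> Tt mt]; split; first by apply/Sigma_phi; split=> //; exact: moves_dom mt.
(* The projection onto a cell where both maps are the same slide witnesses equality of germs. *)
split=> //=; have [L Lh] := near_and ms.2 mt.2.
have KL : (cutoff K <= maxn L (cutoff K))%N by rewrite leq_maxr.
have [e eE] := E_cell KL; exists e.
  by apply/phiP; rewrite eE; exists (maxn L (cutoff K)).
apply: (pmap_op_inj (T_mul (E_T e) Ts) (T_mul (E_T e) Tt)).
rewrite (pmap_op_mul (E_T e) Ts) (pmap_op_mul (E_T e) Tt); apply/funext => y.
rewrite /pthen pmap_op_diag /diag eE; case: ifP => //= Ky.
by have [-> ->] := Lh _ (cell_le (leq_maxl _ _) Ky).
Qed.

Lemma exists_rep K M r : same K M ->
  exists s : op R, [/\ T s, moves K M r (pmap_op s) & germ (phi R K) s = Arr K M r].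
Proof.
move=> /(exists_moves r)[s Ts ms]; have Tp := T_pull R Ts.
have mp : moves K M r (pmap_op (pull s : op R)) by rewrite pmap_op_pull.
by exists (pull s); split=> //; exact: germ_phi.
Qed.

Lemma Arr_inj K M r K' M' r' : same K M -> same K' M' ->
  Arr K M r = Arr K' M' r' -> [/\ K = K', M = M' & r = r'].
Proof.
move=> /(exists_rep r)[s [Ts ms _]] KM' e.
have : Arr K M r (phi R K, s) by [].
rewrite e => -[/= /phi_inj eK _ ms']; move: ms ms'; rewrite eK => ms ms'.
by have [-> ->] := moves_inj ms ms'.
Qed.

Lemma act_phi K M r (s : op R) : T s -> moves K M r (pmap_op s) ->
  act (phi R K) s = phi R M.
Proof.
move=> Ts ms; apply/funext => e; rewrite /act.
have Ec := E_conj e Ts.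
apply/idP/idP => [/(ev_phi _ Ec) h|/phiP h].
  apply/phiP/(near_moves _ ms)/(nearS h) => x; exact: (dom_conj _ _ Ts).1.
apply/(ev_phi _ Ec); move/(near_moves _ ms): h => h.
by apply: (nearS h) => x; exact: (dom_conj _ _ Ts).2.
Qed.

Lemma Sigma_moves K (s : op R) : Sigma (phi R K, s) ->
  exists M r, moves K M r (pmap_op s).
Proof.
move=> /Sigma_phi[Ts h]; have [Tm _] := pmap_opP Ts.
exact: Tmap_moves.
Qed.

Lemma hatE0_meet (x : {ptws E R -> bool}) (e f g : E R) : hatE0 x ->
  E_op g = e ** f -> x g = x e && x f.
Proof. by move=> [_ _ h] gE; rewrite -h -gE evE. Qed.

Lemma T_regular (s : op R) : T s -> s ** adj s ** s = s.
Proof.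
move=> Ts; have Ta := T_adj Ts.
apply: (pmap_op_inj (T_mul (T_mul Ts Ta) Ts) Ts).
rewrite (pmap_op_mul (T_mul Ts Ta) Ts) (pmap_op_mul Ts Ta); apply/funext => x.
rewrite /pthen; case sx: (pmap_op s x) => [y|] //=.
by move/(pmap_op_adj Ts): (sx) => -> /=; rewrite sx.
Qed.

Lemma T_adjK (s : op R) : T s -> adj (adj s) = s.
Proof.
move=> Ts; have Ta := T_adj Ts; apply: (pmap_op_inj (T_adj Ta) Ts).
exact: pinverse_injl (pmap_op_adj Ta) (pinverseC (pmap_op_adj Ts)).
Qed.

(* An arrow with source [phi M] is the inverse of one with range [phi M]. *)
Lemma source_phi M (x : {ptws E R -> bool}) (s : op R) :
  Sigma (x, s) -> phi R M = act x s ->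
  exists K r, x = phi R K /\ moves K M r (pmap_op s).
Proof.
move=> [/= Ts [hx xs]] Mx; have Ta := T_adj Ts.
have [p pE] := E_range Ts.
have xp : x p by rewrite -(evE x p) pE.
have [d] := E_range Ta; rewrite (T_adjK Ts) => dE.
(* At [d = adj s ** s] the value of [phi M] is that of [x] at [s ** d ** adj s = s ** adj s], namely
   1; hence [adj s] is defined near [M]. *)
have : phi R M d.
  rewrite Mx /act dE (_ : _ ** _ ** _ = s ** adj s) //.
  exact: (congr1 (fun a => a ** adj s) (T_regular Ts)).
move=> /phiP h.
have {}h : near_end M (dom (adj s)).
  by apply: (nearS h) => y; have := dom_range y Ta; rewrite (T_adjK Ts) dE => ->.
have [K [r mK]] := Tmap_moves (pmap_opP Ta).1 h.
exists K, (- r); split; last exact: moves_inverse mK (pinverseC (pmap_op_adj Ts)).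
(* Since [x p] holds, [x] agrees at [e] and at [p ** e ** p]. The latter is [s ** f ** adj s] with
   [f = adj s ** e ** s], where the value is that of [phi M] at [f]. *)
apply/funext => e; have [f] := E_conj e Ta; rewrite (T_adjK Ts) => fE.
have [g gE] := E_mul p e; have [g' gE'] := E_mul g p.
have <- : x g' = x e by rewrite (hatE0_meet hx gE') (hatE0_meet hx gE) xp andbT.
have -> : x g' = phi R M f.
  by rewrite Mx /act -(evE x g') gE' gE pE fE.
have Te := E_T e.
apply/idP/idP => [/phiP Mf|/phiP Ke]; apply/phiP.
  apply/(near_moves _ mK)/(nearS Mf) => y.
  by rewrite fE -{2}(T_adjK Ts); exact: (dom_conj _ _ Ta).1.
move/(near_moves _ mK): Ke => Ke; apply: (nearS Ke) => y.
by rewrite fE -{3}(T_adjK Ts); exact: (dom_conj _ _ Ta).2.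
Qed.

Lemma Arr_range K M r : same K M -> has_range (Arr K M r) (phi R K).
Proof.
move=> /(exists_rep r)[s [Ts ms <-]]; exists s; split=> //.
by apply/Sigma_phi; split=> //; exact: moves_dom ms.
Qed.

Lemma Arr_source K M r : same K M -> has_source (Arr K M r) (phi R M).
Proof.
move=> /(exists_rep r)[s [Ts ms <-]]; exists (phi R K), s; split=> //.
  by apply/Sigma_phi; split=> //; exact: moves_dom ms.
by rewrite (act_phi Ts ms).
Qed.

Lemma Arr_tight K M r : same K M -> Gtight (Arr K M r).
Proof.
move=> KM; exists (phi R K), (phi R M); split; [exact: Arr_range|exact: Arr_source| |];
  exact: phi_tight.
Qed.

Lemma range_fibreP K g : range_fibre (phi R K) g <->
  exists M r, same K M /\ g = Arr K M r.
Proof.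
split=> [[_ [s [Ss ->]]]|[M [r [KM ->]]]]; last first.
  by split; [exact: Arr_tight|exact: Arr_range].
have [M [r ms]] := Sigma_moves Ss; exists M, r; split; first exact: ms.1.
exact: germ_phi Ss.1 ms.
Qed.

Lemma source_fibreP M g : source_fibre (phi R M) g <->
  exists K r, same K M /\ g = Arr K M r.
Proof.
split=> [[_ [x [s [Ss -> e]]]]|[K [r [KM ->]]]]; last first.
  by split; [exact: Arr_tight|exact: Arr_source].
have [K [r [xE ms]]] := source_phi Ss e; exists K, r; split; first exact: ms.1.
by rewrite xE; exact: germ_phi Ss.1 ms.
Qed.

Lemma isotropyP K g : isotropy (phi R K) g <-> exists r, g = Arr K K r.
Proof.
split=> [[/range_fibreP[M [r [KM ->]]] /source_fibreP[K' [r' [KK e]]]]|[r ->]].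
  by have [_ -> _] := Arr_inj KM KK e; exists r.
by split; [apply/range_fibreP; exists K, r|apply/source_fibreP; exists K, r].
Qed.

Lemma germ_refl (x : {ptws E R -> bool}) (s : op R) : Sigma (x, s) -> germ x s (x, s).
Proof. by move=> Ss; have [_ [[[e xe] _ _] _]] := Ss; split=> //; split=> //; exists e. Qed.

(** [gmul] ranges over all pairs of representatives; motions compose with degrees adding, so every
    pair yields the same arrow. *)
Lemma gmul_Arr K M N r r' : same K M -> same M N ->
  gmul (Arr K M r) (Arr M N r') = Arr K N (r + r').
Proof.
move=> KM MN; have KN := same_trans KM MN; apply/seteqP; split=> q.
  move=> [x [s [s' [Ss Ss' eg eh]]]].
  have : Arr K M r (x, s) by rewrite eg; exact: germ_refl.
  move=> [/= xE Ts ms]; move: Ss' eh; rewrite xE (act_phi Ts ms) => Ss' eh.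
  have : Arr M N r' (phi R M, s') by rewrite eh; exact: germ_refl.
  move=> [/= _ Ts' ms']; rewrite (germ_phi (r := r + r') (M := N)) //.
    exact: T_mul.
  by rewrite pmap_op_mul //; exact: moves_comp ms ms'.
have [s [Ts ms es]] := exists_rep r KM; have [s' [Ts' ms' es']] := exists_rep r' MN.
move=> qA; exists (phi R K), s, s'; rewrite (act_phi Ts ms); split=> //.
- by apply/Sigma_phi; split=> //; exact: moves_dom ms.
- by apply/Sigma_phi; split=> //; exact: moves_dom ms'.
rewrite (germ_phi (r := r + r') (M := N)) //; first exact: T_mul.
by rewrite pmap_op_mul //; exact: moves_comp ms ms'.
Qed.

(** * Parametrizations of the fibres and isotropy groups *)

Lemma germ_code K M c : valid c ->
  fits (ray1 c) (src1 c) (tgt1 c) K.1 M.1 ->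
  fits (ray2 c) (src2 c) (tgt2 c) K.2 M.2 ->
  germ (phi R K) (pull (pmap_of c)) = Arr K M (deg c).
Proof.
move=> vc f1 f2; have Tc : Tmap (pmap_of c) by right; exists c.
by apply: germ_phi; [exact: T_pull|rewrite pmap_op_pull //; exact: moves_code].
Qed.

(** The two branches by sign of [r] are two families of representatives for one family [A]; the
    second conclusion lets additivity of [A] pass to the glued map. *)
Lemma bij_ZP (F : set (arrow R)) (a b A : int -> arrow R) :
  (forall r, 0 <= r -> a r = A r) -> (forall r, r < 0 -> b r = A r) ->
  injective A -> (forall g, F g <-> exists r, g = A r) ->
  bij_Z F a b /\ Defs.glue a b = A.
Proof.
move=> aA bA Ai FA.
have gA : Defs.glue a b = A.
  by apply/funext => r; rewrite /Defs.glue; case: (leP 0 r) => [/aA|/bA].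
split=> //; split; last first.
  rewrite gA; split; last by move=> g /FA[r ->]; exists r.
    by move=> r _; apply/FA; exists r.
  by move=> r r' _ _; exact: Ai.
apply/seteqP; split=> g.
  move=> /FA[r ->]; case: (leP 0 r) => r0; [left|right]; exists r => //=.
    exact: aA.
  exact: bA.
by case=> -[r /= r0 <-]; apply/FA; exists r; [rewrite aA|rewrite bA].
Qed.

Lemma bij_NZP (F : set (arrow R)) (a b A : nat -> int -> arrow R) :
  (forall m r, 0 <= r -> a m r = A m r) -> (forall m r, r < 0 -> b m r = A m r) ->
  (forall m r m' r', A m r = A m' r' -> m = m' /\ r = r') ->
  (forall g, F g <-> exists m r, g = A m r) -> bij_NZ F a b.
Proof.
move=> aA bA Ai FA.
have gA m r : Defs.glue (a m) (b m) r = A m r.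
  by rewrite /Defs.glue; case: (leP 0 r) => [/aA|/bA].
split; last first.
  split; last by move=> g /FA[m [r ->]]; exists (m, r) => //=; rewrite gA.
    by move=> [m r] _; apply/FA; exists m, r; rewrite /= gA.
  by move=> [m r] [m' r'] _ _ /=; rewrite !gA => /Ai[-> ->].
apply/seteqP; split=> g.
  move=> /FA[m [r ->]]; case: (leP 0 r) => r0; [left|right]; exists m, r; split => //.
    by rewrite aA.
  by rewrite bA.
by case=> -[m [r [r0 ->]]]; apply/FA; exists m, r; [rewrite aA|rewrite bA].
Qed.

Lemma bij_NNZP (F : set (arrow R)) (a : nat * nat -> int -> arrow R) :
  (forall m r m' r', a m r = a m' r' -> m = m' /\ r = r') ->
  (forall g, F g <-> exists m r, g = a m r) -> bij_NNZ F a.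
Proof.
move=> ai FA; split; first by apply/seteqP; split=> g /FA.
split; last by move=> g /FA[m [r ->]]; exists (m, r).
  by move=> [m r] _; apply/FA; exists m, r.
by move=> [m r] [m' r'] _ _ /= /ai[-> ->].
Qed.

End Characters.

Theorem lemma4p2 (R : realType) (k1 k2 : nat) :
  let phioo := phi R (None, None) in
  let phio2 n := phi R (None, Some n) in
  let phi1o n := phi R (Some n, None) in
  let phikk (n : nat * nat) := phi R (Some n.1, Some n.2) in
  let k := (k1, k2) in
  (* (a) range fibres *)
  [/\ bij_Z (range_fibre phioo)
        (fun r => germ phioo (B1 R r (0, 0)%N (`|r|, `|r|)%N))
        (fun r => germ phioo (B1 R r (`|r|, `|r|)%N (0, 0)%N)),
      bij_NZ (range_fibre (phio2 k2))
        (fun m r => germ (phio2 k2)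
           (B2 R r (k2 + m, k2)%N (`|r| + k2 + m, m)%N))
        (fun m r => germ (phio2 k2)
           (B2 R r (k2 + m + `|r|, k2)%N (k2 + m, m)%N)),
      bij_NZ (range_fibre (phi1o k1))
        (fun m r => germ (phi1o k1)
           (B3 R r (k1, k1 + m)%N (m, `|r| + k1 + m)%N))
        (fun m r => germ (phi1o k1)
           (B3 R r (k1, k1 + m + `|r|)%N (m, k1 + m)%N))
    & bij_NNZ (range_fibre (phikk k))
        (fun m r => germ (phikk k) (B4 R r k m))]
  /\
  (* (b) source fibres *)
  [/\ bij_Z (source_fibre phioo)
        (fun r => germ phioo (B1 R r (0, 0)%N (`|r|, `|r|)%N))
        (fun r => germ phioo (B1 R r (`|r|, `|r|)%N (0, 0)%N)),
      bij_NZ (source_fibre (phio2 k2))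
        (fun n r => germ (phio2 n)
           (B2 R r (n + k2, n)%N (`|r| + n + k2, k2)%N))
        (fun n r => germ (phio2 n)
           (B2 R r (n + k2 + `|r|, n)%N (n + k2, k2)%N)),
      bij_NZ (source_fibre (phi1o k1))
        (fun n r => germ (phi1o n)
           (B3 R r (n, n + k1)%N (k1, `|r| + n + k1)%N))
        (fun n r => germ (phi1o n)
           (B3 R r (n, n + k1 + `|r|)%N (k1, n + k1)%N))
    & bij_NNZ (source_fibre (phikk k))
        (fun n r => germ (phikk n) (B4 R r n k))]
  /\
  (* (c) isotropy groups *)
  [/\ iso_Z (isotropy phioo)
        (fun r => germ phioo (B1 R r (0, 0)%N (`|r|, `|r|)%N))
        (fun r => germ phioo (B1 R r (`|r|, `|r|)%N (0, 0)%N)),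
      iso_Z (isotropy (phio2 k2))
        (fun r => germ (phio2 k2)
           (B2 R r (2 * k2, k2)%N (`|r| + 2 * k2, k2)%N))
        (fun r => germ (phio2 k2)
           (B2 R r (2 * k2 + `|r|, k2)%N (2 * k2, k2)%N)),
      iso_Z (isotropy (phi1o k1))
        (fun r => germ (phi1o k1)
           (B3 R r (k1, 2 * k1)%N (k1, `|r| + 2 * k1)%N))
        (fun r => germ (phi1o k1)
           (B3 R r (k1, 2 * k1 + `|r|)%N (k1, 2 * k1)%N))
    & iso_Z1 (isotropy (phikk k))
        (fun r => germ (phikk k) (B4 R r k k))].
Proof.
move=> phioo phio2 phi1o phikk k.
have oo : same (None, None) (None, None) by [].
have o2 m n : same (None, Some m) (None, Some n) by [].
have o1 m n : same (Some m, None) (Some n, None) by [].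
have fin (m n : nat * nat) : same (Some m.1, Some m.2) (Some n.1, Some n.2) by [].
have code1 r n m : n.1 = n.2 -> m.1 = m.2 -> r = m.1%:Z - n.1%:Z ->
    germ phioo (B1 R r n m) = @Arr R (None, None) (None, None) r.
  by move=> nn mm rE; rewrite B1E; apply: germ_code => //=; split=> /= _; split; lia.
(* The entries [k2 + m] and [k2 + m] plus the absolute value of [r] in the statement make the first
   coordinates dominate [k2] and [m] for either sign of [r]; the isotropy case [m = k2] gives
   [2 * k2]. *)
have code2 r n m l : r = m.1%:Z - n.1%:Z -> (n.2 <= n.1)%N -> (m.2 <= m.1)%N ->
    n.2 = l -> germ (phio2 l) (B2 R r n m) = @Arr R (None, Some l) (None, Some m.2) r.
  by move=> rE nn mm nl; rewrite B2E; apply: germ_code.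
have code3 r n m l : r = m.2%:Z - n.2%:Z -> (n.1 <= n.2)%N -> (m.1 <= m.2)%N ->
    n.1 = l -> germ (phi1o l) (B3 R r n m) = @Arr R (Some l, None) (Some m.1, None) r.
  by move=> rE nn mm nl; rewrite B3E; apply: germ_code.
have code4 r n m : germ (phikk n) (B4 R r n m) =
    @Arr R (Some n.1, Some n.2) (Some m.1, Some m.2) r.
  by rewrite B4E; apply: germ_code.
have Arr_injr K : injective (@Arr R K K).
  by move=> r r' /(Arr_inj (conj erefl erefl) (conj erefl erefl))[].
have morph K : morph_Z (@Arr R K K) by move=> r r'; rewrite gmul_Arr.
have bij1 (F : set (arrow R)) : (forall g, F g <-> exists r, g = @Arr R (None, None) (None, None) r) ->
    bij_Z F (fun r => germ phioo (B1 R r (0, 0)%N (`|r|, `|r|)%N))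
        (fun r => germ phioo (B1 R r (`|r|, `|r|)%N (0, 0)%N)) /\
    Defs.glue (fun r => germ phioo (B1 R r (0, 0)%N (`|r|, `|r|)%N))
        (fun r => germ phioo (B1 R r (`|r|, `|r|)%N (0, 0)%N)) = @Arr R (None, None) (None, None).
  move=> FA; apply: bij_ZP => // r r0; apply: code1 => //=; lia.
split; last split.
- split.
  + apply: (bij1 _ _).1 => g; split=> [/range_fibreP[[[?|] [?|]] [r [[] // _ _ ->]]]|[r ->]].
      by exists r.
    by apply/range_fibreP; exists (None, None), r.
  + apply: (bij_NZP (A := fun m r => @Arr R (None, Some k2) (None, Some m) r)).
    * by move=> m r r0; rewrite code2 //=; lia.
    * by move=> m r r0; rewrite code2 //=; lia.
    * by move=> m r m' r' /(Arr_inj (o2 _ _) (o2 _ _))[_ [->] ->].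
    * move=> g; split=> [/range_fibreP[[[?|] [m|]] [r [[] // _ _ ->]]]|[m [r ->]]].
        by exists m, r.
      by apply/range_fibreP; exists (None, Some m), r.
  + apply: (bij_NZP (A := fun m r => @Arr R (Some k1, None) (Some m, None) r)).
    * by move=> m r r0; rewrite code3 //=; lia.
    * by move=> m r r0; rewrite code3 //=; lia.
    * by move=> m r m' r' /(Arr_inj (o1 _ _) (o1 _ _))[_ [->] ->].
    * move=> g; split=> [/range_fibreP[[[m|] [?|]] [r [[] // _ _ ->]]]|[m [r ->]]].
        by exists m, r.
      by apply/range_fibreP; exists (Some m, None), r.
  + apply: bij_NNZP => [m r m' r'|g].
      rewrite !code4 => /(Arr_inj (fin k m) (fin k m'))[_ [e1 e2] ->]; split=> //.
      by case: m m' e1 e2 => ? ? [? ?] /= -> ->.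
    split=> [/range_fibreP[[[m1|] [m2|]] [r [[] // _ _ ->]]]|[m [r ->]]].
      by exists (m1, m2), r; rewrite code4.
    by rewrite code4; apply/range_fibreP; exists (Some m.1, Some m.2), r.
- split.
  + apply: (bij1 _ _).1 => g; split=> [/source_fibreP[[[?|] [?|]] [r [[] // _ _ ->]]]|[r ->]].
      by exists r.
    by apply/source_fibreP; exists (None, None), r.
  + apply: (bij_NZP (A := fun n r => @Arr R (None, Some n) (None, Some k2) r)).
    * by move=> n r r0; rewrite code2 //=; lia.
    * by move=> n r r0; rewrite code2 //=; lia.
    * by move=> n r n' r' /(Arr_inj (o2 _ _) (o2 _ _))[[->] _ ->].
    * move=> g; split=> [/source_fibreP[[[?|] [n|]] [r [[] // _ _ ->]]]|[n [r ->]]].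
        by exists n, r.
      by apply/source_fibreP; exists (None, Some n), r.
  + apply: (bij_NZP (A := fun n r => @Arr R (Some n, None) (Some k1, None) r)).
    * by move=> n r r0; rewrite code3 //=; lia.
    * by move=> n r r0; rewrite code3 //=; lia.
    * by move=> n r n' r' /(Arr_inj (o1 _ _) (o1 _ _))[[->] _ ->].
    * move=> g; split=> [/source_fibreP[[[n|] [?|]] [r [[] // _ _ ->]]]|[n [r ->]]].
        by exists n, r.
      by apply/source_fibreP; exists (Some n, None), r.
  + apply: bij_NNZP => [n r n' r'|g].
      rewrite !code4 => /(Arr_inj (fin n k) (fin n' k))[[e1 e2] _ ->]; split=> //.
      by case: n n' e1 e2 => ? ? [? ?] /= -> ->.
    split=> [/source_fibreP[[[n1|] [n2|]] [r [[] // _ _ ->]]]|[n [r ->]]].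
      by exists (n1, n2), r; rewrite code4.
    by rewrite code4; apply/source_fibreP; exists (Some n.1, Some n.2), r.
- split.
  (* [g] identifies the glued map with [Arr], which is additive by [morph]. *)
  + have [b g] := bij1 _ (isotropyP (None, None)).
    by split; [|rewrite g].
  + rewrite /iso_Z.
    have [|||g|b g] := @bij_ZP R (isotropy (phio2 k2))
      (fun r => germ (phio2 k2) (B2 R r (2 * k2, k2)%N (`|r| + 2 * k2, k2)%N))
      (fun r => germ (phio2 k2) (B2 R r (2 * k2 + `|r|, k2)%N (2 * k2, k2)%N))
      (@Arr R (None, Some k2) (None, Some k2)).
    * by move=> r r0; rewrite code2 //=; lia.
    * by move=> r r0; rewrite code2 //=; lia.
    * exact: Arr_injr.
    * exact: isotropyP.
    * by split; [|rewrite g].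
  + have [|||g|b g] := @bij_ZP R (isotropy (phi1o k1))
      (fun r => germ (phi1o k1) (B3 R r (k1, 2 * k1)%N (k1, `|r| + 2 * k1)%N))
      (fun r => germ (phi1o k1) (B3 R r (k1, 2 * k1 + `|r|)%N (k1, 2 * k1)%N))
      (@Arr R (Some k1, None) (Some k1, None)).
    * by move=> r r0; rewrite code3 //=; lia.
    * by move=> r r0; rewrite code3 //=; lia.
    * exact: Arr_injr.
    * exact: isotropyP.
    * by split; [|rewrite g].
  + have -> : (fun r => germ (phikk k) (B4 R r k k)) =
        @Arr R (Some k1, Some k2) (Some k1, Some k2).
      by apply/funext => r; rewrite code4.
    have FA := @isotropyP R (Some k1, Some k2).
    split; last exact: morph.
      by apply/seteqP; split=> g; [move=> /FA[r ->]; exists r|move=> [r _ <-]; apply/FA; exists r].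
    split; last by move=> g /FA[r ->]; exists r.
      by move=> r _; apply/FA; exists r.
    by move=> r r' _ _; exact: Arr_injr.
Qed.
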